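(* Let $q>1$, and let $(V,E,\mu)$ be a weighted graph with vertex weight $\sigma$ and a $\nu$-adapted edge-length function $\rho$ whose path metric $d_\rho$ is proper (as in the context). If, for some $o\in V$, $$\int_1^\infty\frac{r}{M_o(2r)^{q-1}}\log\!\left(1+\frac{M_o(2r)}{r^2\,\mathcal C_{o,\rho}(r)}\right)dr=\infty,$$ then every nonnegative global classical supersolution of $$\partial_tu-\Delta_\sigma u\ge u^q\qquad\text{on }(0,\infty)\times V$$ vanishes identically.
   Context: Let $(V,E)$ be an infinite, connected, locally finite graph with at most one edge between two distinct vertices and no loops. Let $\mu:V\times V\to[0,\infty)$ be symmetric with $\mu_{xy}>0$ if $x\sim y$ and $\mu_{xy}=0$ otherwise; put $\mu(x)=\sum_{y\sim x}\mu_{xy}$. Fix $\sigma:V\to(0,\infty)$ and set $\nu(x)=\sigma(x)\mu(x)$, $\nu(A)=\sum_{x\in A}\nu(x)$. The operator is $$\Delta_\sigma f(x)=\frac1{\nu(x)}\sum_{y\sim x}\mu_{xy}(f(y)-f(x)).$$ A positive symmetric edge-length function $\rho:E\to(0,\infty)$ is $\nu$-adapted if $\sum_{y\sim x}\mu_{xy}\rho(x,y)^2\le\nu(x)$ for all $x\in V$. Its path metric is $d_\rho(x,y)=\inf\sum_{i=1}^n\rho(x_{i-1},x_i)$, the infimum over paths $x=x_0\sim x_1\sim\dots\sim x_n=y$. Properness of $d_\rho$ means that every ball $B_\rho(o,r)=\{x\in V:d_\rho(o,x)\le r\}$ is finite. Put $M_o(r)=\nu(B_\rho(o,r))$. $\ell_0(V)$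 is the space of finitely supported real functions on $V$, and $\mathcal E_{\mathrm D}(f)=\frac12\sum_{x}\sum_{y\sim x}\mu_{xy}(f(x)-f(y))^2$. For $0<r<R$, $$\mathcal C_{o,\rho}(r,R)=\inf\bigl\{\mathcal E_{\mathrm D}(f): f\in\ell_0(V),\ f=1\text{ on }B_\rho(o,r),\ f=0\text{ on }V\setminus B_\rho(o,R)\bigr\},$$ and $\mathcal C_{o,\rho}(r)=\mathcal C_{o,\rho}(r,2r)$. A nonnegative global classical supersolution of $\partial_tu-\Delta_\sigma u\ge u^q$ on $(0,\infty)\times V$ is a function $u:(0,\infty)\times V\to[0,\infty)$ with $u(\cdot,x)\in C^1((0,\infty))$ for every $x\in V$ satisfying the inequality pointwise; no value or trace at $t=0$ is assumed. *)

(* Defs.v *)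
From mathcomp Require Import all_boot all_order all_algebra.
From mathcomp Require Import all_classical all_reals all_analysis.

Set Implicit Arguments.
Unset Strict Implicit.
Unset Printing Implicit Defensive.

Import Order.TTheory GRing.Theory Num.Theory.
Import numFieldNormedType.Exports.
Local Open Scope classical_set_scope.
Local Open Scope ring_scope.

(* Sums [\sum_(x \in A) F x] below are the library's finitely supported sums,
   which are 0 when [F] has infinite support on [A].  They are only used over
   neighbourhoods (finite by local finiteness), over balls of a proper metric,
   and in the energy of finitely supported functions, where the support of the
   summand is finite. *)

Record weighted_graph (R : realType) (V : choiceType) := WeightedGraph {
  adj : rel V ;
  weight : V -> V -> R ;
  adj_sym : forall x y, adj x y = adj y x ;
  adj_irrefl : forall x, ~~ adj x x ;
  vertices_infinite : infinite_set [set: V] ;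
  connected_graph : forall x y, exists2 p : seq V, path adj x p & last x p = y ;
  locally_finite : forall x, finite_set [set y | adj x y] ;
  weight_sym : forall x y, weight x y = weight y x ;
  weight_gt0 : forall x y, adj x y -> 0 < weight x y ;
  weight_eq0 : forall x y, ~~ adj x y -> weight x y = 0
}.

Section WeightedGraph.
Context (R : realType) (V : choiceType) (G : weighted_graph R V).
Implicit Types (sigma : V -> R) (rho : V -> V -> R) (f : V -> R) (x y o : V).

Definition nbrs x : set V := [set y | adj G x y].

Definition mu_vertex x : R := \sum_(y \in nbrs x) weight G x y.

Definition nu sigma x : R := sigma x * mu_vertex x.

Definition nu_set sigma (A : set V) : R := \sum_(x \in A) nu sigma x.

Definition laplacian sigma f x : R :=
  (nu sigma x)^-1 * \sum_(y \in nbrs x) weight G x y * (f y - f x).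

(* Only the values of [rho] on edges matter. *)
Definition edge_length rho : Prop :=
  forall x y, adj G x y -> 0 < rho x y /\ rho x y = rho y x.

Definition adapted sigma rho : Prop :=
  forall x, \sum_(y \in nbrs x) weight G x y * rho x y ^+ 2 <= nu sigma x.

(* The path is [x :: p], so that [p = [::]] is the trivial path, of length 0. *)
Definition path_length rho x (p : seq V) : R := \sum_(l <- pairmap rho x p) l.

Definition path_metric rho x y : R :=
  inf [set path_length rho x p | p in [set p | path (adj G) x p /\ last x p = y]].

Definition rball rho o (r : R) : set V := [set x | path_metric rho o x <= r].

Definition proper_metric rho : Prop := forall o r, finite_set (rball rho o r).

Definition volume sigma rho o (r : R) : R := nu_set sigma (rball rho o r).

Definition energy f : R :=
  2^-1 * \sum_(x \in [set: V]) \sum_(y \in nbrs x) weight G x y * (f x - f y) ^+ 2.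

Definition cap_test rho o (r s : R) : set (V -> R) :=
  [set f | [/\ finite_set [set x | f x != 0],
               forall x, rball rho o r x -> f x = 1 &
               forall x, ~ rball rho o s x -> f x = 0]].

Definition capacity2 rho o (r s : R) : R :=
  inf [set energy f | f in cap_test rho o r s].

Definition capacity rho o (r : R) : R := capacity2 rho o r (2 * r).

Definition C1_pos (g : R -> R) : Prop :=
  forall t, 0 < t -> derivable g t 1 /\ {for t, continuous (derive1 g)}.

(* [u] is a total function of time, of which only the values at [0 < t] are
   constrained; derivatives at such [t] do not see the values at [t <= 0]. *)
Definition nonneg_supersolution sigma (q : R) (u : R -> V -> R) : Prop :=
  [/\ forall t x, 0 < t -> 0 <= u t x,
      forall x, C1_pos (fun t => u t x) &
      forall t x, 0 < t ->
        u t x `^ q <= derive1 (fun s => u s x) t - laplacian sigma (u t) x].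

End WeightedGraph.

(* Main.v *)
Require Import Defs.
From mathcomp Require Import all_boot all_order all_algebra finmap.
From mathcomp Require Import all_classical all_reals all_analysis.
From mathcomp Require Import measurable_realfun ring lra.
Import Order.TTheory GRing.Theory Num.Theory.
Import numFieldNormedType.Exports.
Local Open Scope classical_set_scope.
Local Open Scope ring_scope.
Set Implicit Arguments.
Unset Strict Implicit.
Unset Printing Implicit Defensive.

(** Write M(r) and C(r) for the volume and the capacity of the ball of radius r
    around o, and suppose that u is positive at some point.  The proof bounds
    the integral of the theorem.

    _One scale_ ([caccioppoli]).  Fix r, a level K, and put v = 1 + u/K.  The
    inequality is tested with a time cutoff times the nonlinear [profile]
      Theta = zeta (1 + v^-a - 2/v) + 2 chi^2 / v,
    where zeta is a power of the metric cutoff between r/2 and r, and chi is a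
    nearly optimal potential for C(r), equal to 1 where zeta is positive.
    Theta decreases in u, which yields a gradient term of the good sign; it
    lies between zeta and 2.  Its coefficient of zeta vanishes like u/K when u
    is small.  So where u is below K only chi is felt, and its gradient costs
    at most K C(r) in all, while the gradient of zeta, of size 1/r, costs at
    most K (u/K)^(1+a) / r^2; since 1 < 1 + a < q, this is small against
    (K0 + K0^(1-q) u^q) / r^2 when K is large against a given level K0.  With
    K = lambda K0 the two losses are equal when
    lambda^(1+a) = x := max(1, M(2r) / (r^2 C(r))), and then both behave like
    1/T with
      T = r^2 x^(a/(1+a)).
    This gains over the time scale r^2 of the metric cutoff alone.  If B is the
    integral of u^q Theta up to time 2T, and D the part of it in the time
    interval [T, 2T] or carried by edges across which zeta varies, then
      B <= const (K0 M(2r) + K0^(1-q) D / T)     for every K0 > 0.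

    _Summing over scales_ ([sum_scales_bounded]).  Let A be the integral of u^q
    over the ball of radius r/2 and times up to T.  Taking K0 proportional to
    A / M(2r) gives T M(2r)^(1-q) <= const min(A^(1-q), A^(-q) D).  Along
    scales whose radii and times grow by factors 4, the sets that carry the
    quantities D overlap boundedly, so E_i = E_0 + D_0 + ... + D_(i-1) is at
    most const A_i, and T_i M_i^(1-q) <= const (E_i^(1-q) - E_(i+1)^(1-q)).
    This telescopes.

    _The logarithm_ ([weighted_sum_bounded_from]).  The times T_i of a lacunary
    sequence of radii need not increase, so only the record values of T_i are
    used.  As ln(1+x) <= const x^(a/(2(1+a))), the term r_i^2 ln(1+x_i) is at
    most const r_i sqrt(T_i), and the sum of these over all scales between one
    record and the next is geometric, bounded by the time of the record.  Hence
    the sums of r_i^2 M(2r_i)^(1-q) ln(1+x_i) are bounded.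

    _The integral_ ([integral_block_le]).  The integral over [4^k, 4^(k+1)) is
    bounded through a radius r_k at which the integrand is at least half its
    supremum; the even and the odd blocks give two lacunary sequences. *)

(** * Elementary inequalities for real powers *)

Section ScalarInequalities.
Context {R : realType}.
Implicit Types (a p q v w z K : R).

Lemma powRN_tangent a v w : 0 <= a -> 0 < w -> w <= v ->
  a * v `^ (- a - 1) * (v - w) <= w `^ (- a) - v `^ (- a).
Proof.
move=> a0 w0 wv; have v0 : 0 < v by exact: lt_le_trans wv.
pose s := w / v.
have s0 : 0 < s by rewrite divr_gt0.
have ws : w = s * v by rewrite /s divfK// gt_eqF.
have key : 1 + a * (1 - s) <= s `^ (- a).
  rewrite /powR gt_eqF//; apply: le_trans (expR_ge1Dx _).
  rewrite lerD2l mulNr -mulrN ler_wpM2l//.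
  have := @le_ln1Dx R (s - 1); rewrite addrCA subrr addr0 => h.
  by rewrite lerNr opprB h// ltrBrDl subrr.
have -> : v `^ (- a - 1) = v `^ (- a) / v.
  by rewrite powRD ?powR_inv1 ?ltW// (gt_eqF v0) implybT.
have -> : w `^ (- a) = s `^ (- a) * v `^ (- a) by rewrite ws powRM// ltW.
have -> : a * (v `^ (- a) / v) * (v - w) = (a * (1 - s)) * v `^ (- a).
  by rewrite ws; field; rewrite gt_eqF.
have -> : s `^ (- a) * v `^ (- a) - v `^ (- a) = (s `^ (- a) - 1) * v `^ (- a).
  by rewrite mulrBl mul1r.
by rewrite ler_wpM2r ?powR_ge0// lerBrDl.
Qed.

(** The right-hand side exceeds the left by a square over [v * w].  This is what makes
    [2 chi^2 / v] a good test function: the energy it exchanges through an edge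
    is controlled by the gradient of [chi] alone, whatever the values of [u]. *)
Lemma resistor_ineq v w (X Y : R) : 0 < v -> 0 < w ->
  (v - w) * (X ^+ 2 / v - Y ^+ 2 / w) <= (X - Y) ^+ 2.
Proof.
move=> v0 w0.
have -> : (v - w) * (X ^+ 2 / v - Y ^+ 2 / w) =
  (X - Y) ^+ 2 - (X * w - Y * v) ^+ 2 / (v * w).
  by field; rewrite !gt_eqF.
by rewrite gerBl divr_ge0 ?sqr_ge0// mulr_ge0// ltW.
Qed.

(** The quotient z/(1+z) is at most 1, so lowering its exponent from 2 to p
    does not decrease it; this converts the quadratic terms produced by the test
    profile into the power 1 + a. *)
Lemma sqr_le_powR p z : 1 <= p -> p <= 2 -> 0 <= z ->
  z ^+ 2 <= z `^ p * (1 + z) `^ (2 - p).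
Proof.
move=> p1 p2; rewrite le_eqVlt => /predU1P[<-|z0].
  by rewrite expr0n mulr_ge0 ?powR_ge0.
have -> : z ^+ 2 = z `^ p * z `^ (2 - p).
  rewrite -powRD; last by rewrite (gt_eqF z0) implybT.
  by rewrite addrCA subrr addr0 (powR_mulrn 2 (ltW z0)).
rewrite ler_wpM2l ?powR_ge0// ge0_ler_powR ?nnegrE ?subr_ge0//; lra.
Qed.

Lemma sqr_div_le_powR p z : 1 <= p -> p <= 2 -> 0 <= z ->
  z ^+ 2 / (1 + z) <= z `^ p.
Proof.
move=> p1 p2 z0; have v0 : 0 < 1 + z by lra.
rewrite ler_pdivrMr//; apply: le_trans (sqr_le_powR p1 p2 z0) _.
rewrite ler_wpM2l ?powR_ge0//.
rewrite -[leRHS]powRr1 ?(ltW v0)// ler_powR//; lra.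
Qed.

(** With [v = 1 + u/K], the primitive [K ln v] of [1/v] is at most a multiple of
    [u v^(-1/q)], whose q-th power is [u^q / v]: exactly the weight that
    the energy estimate controls. *)
Lemma ln_le_powR q v : 1 < q -> 1 <= v ->
  ln v <= q / (q - 1) * ((v - 1) * v `^ (- q^-1)).
Proof.
move=> q1 v1; have v0 : 0 < v by lra.
pose e := 1 - q^-1.
have q0 : 0 < q by lra.
have e0 : 0 < e by rewrite /e subr_gt0 invf_lt1.
have eq : e^-1 = q / (q - 1) by rewrite /e; field; rewrite !gt_eqF//; lra.
have h1 : e * ln v <= v `^ e - 1.
  rewrite -ln_powR.
  have := @le_ln1Dx R (v `^ e - 1); rewrite addrCA subrr addr0; apply.
  by rewrite ltrBrDl subrr powR_gt0.
have h2 : v `^ e = v * v `^ (- q^-1).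
  by rewrite /e powRD ?powRr1 ?ltW// (gt_eqF v0) implybT.
have h3 : v `^ (- q^-1) <= 1.
  rewrite -(powRr0 v) ler_powR// oppr_le0 invr_ge0; lra.
rewrite -eq mulrC ler_pdivlMr// mulrC (le_trans h1)// h2 mulrBl mul1r; lra.
Qed.

Lemma powR_bernoulli (b : R) v : 0 <= b -> b <= 1 -> 0 < v ->
  v `^ b <= 1 + b * (v - 1).
Proof.
move=> b0 b1 v0.
have b01 : 0 <= b <= 1 by rewrite b0 b1.
have := @concave_ln R (Itv01 b0 b1) v 1 v0 ltr01.
rewrite !convRE /= ln1 mulr0 addr0.
have -> : b * v + (1 - b) * 1 = 1 + b * (v - 1) by ring.
move=> h; rewrite /powR gt_eqF//.
rewrite -[leRHS]lnK ?posrE ?ler_expR//.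
have bv : 0 <= b * v by rewrite mulr_ge0// ltW.
rewrite mulrBr mulr1; have [bl1|] := ltrP b 1; first lra.
move=> b1'; have -> : b = 1 by lra.
by rewrite mul1r; lra.
Qed.

Lemma powR_le1D p q w : 0 <= p -> p <= q -> 0 <= w -> w `^ p <= 1 + w `^ q.
Proof.
move=> p0 pq w0; case: (lerP w 1) => w1.
  apply: (@le_trans _ _ 1); last by rewrite lerDl powR_ge0.
  have <- : 1 `^ p = 1 :> R by rewrite powR1.
  by rewrite ge0_ler_powR// ?nnegrE.
by apply: (@le_trans _ _ (w `^ q)); [rewrite ler_powR// ltW|rewrite lerDr].
Qed.

Lemma ln1D_le_powR (e x : R) : 0 < e -> 1 <= x ->
  ln (1 + x) <= (1 + e^-1) * x `^ e.
Proof.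
move=> e0 x1; have x0 : 0 < x by lra.
apply: (@le_trans _ _ (ln (2 * x))).
  by rewrite ler_ln ?posrE; lra.
rewrite lnM ?posrE// mulrDl mul1r; apply: lerD.
  apply: (@le_trans _ _ 1); last by rewrite -(powRr0 x) ler_powR// ltW.
  have := @le_ln1Dx R 1; rewrite -[1 + 1]/(2 : R); apply; lra.
rewrite mulrC ler_pdivlMr// mulrC -ln_powR.
by apply/ltW/ln_sublinear; rewrite powR_gt0.
Qed.

End ScalarInequalities.

(** * Time integrals of functions continuous on the positive half-line *)

Section TimeIntegral.
Context {R : realType}.
Implicit Types (a b c t : R) (f g h : R -> R).

Definition tint a b h : R := (\int[lebesgue_measure]_(t in `[a, b]) h t)%R.

Definition cont_pos h := forall t, 0 < t -> {for t, continuous h}.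

Lemma cont_posD f g : cont_pos f -> cont_pos g -> cont_pos (fun t => f t + g t).
Proof. by move=> cf cg t t0; apply: continuousD; [exact: cf|exact: cg]. Qed.

Lemma cont_posM f g : cont_pos f -> cont_pos g -> cont_pos (fun t => f t * g t).
Proof. by move=> cf cg t t0; apply: continuousM; [exact: cf|exact: cg]. Qed.

Lemma cont_pos_cst c : cont_pos (fun=> c).
Proof. by move=> t t0; exact: cvg_cst. Qed.

Lemma cont_posZ c f : cont_pos f -> cont_pos (fun t => c * f t).
Proof. by move=> cf; apply: cont_posM cf; exact: cont_pos_cst. Qed.

Lemma cont_posX n f : cont_pos f -> cont_pos (fun t => f t ^+ n).
Proof.
move=> cf; elim: n => [|n IH]; first exact: cont_pos_cst.
by under eq_fun do rewrite exprS; exact: cont_posM.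
Qed.

Lemma cont_pos_sum (I : Type) (s : seq I) (F : I -> R -> R) :
  (forall i, cont_pos (F i)) -> cont_pos (fun t => \sum_(i <- s) F i t).
Proof.
move=> cF; elim: s => [|i s IH].
  by under eq_fun do rewrite big_nil; exact: cont_pos_cst.
by under eq_fun do rewrite big_cons; exact: cont_posD.
Qed.

Lemma cont_pos_integrable a b h : 0 < a -> cont_pos h ->
  lebesgue_measure.-integrable `[a, b] (EFin \o h).
Proof.
move=> a0 ch; apply: continuous_compact_integrable; first exact: segment_compact.
apply: continuous_in_subspaceT => t; rewrite inE/= in_itv/= => /andP[at_ _].
by apply: ch; exact: lt_le_trans at_.
Qed.

Lemma eq_tint a b f g : (forall t, a <= t <= b -> f t = g t) ->
  tint a b f = tint a b g.
Proof. by move=> fg; apply: eq_Rintegral => t; rewrite inE/= in_itv/=; exact: fg. Qed.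

Lemma le_tint a b f g : 0 < a -> cont_pos f -> cont_pos g ->
  (forall t, a <= t <= b -> f t <= g t) -> tint a b f <= tint a b g.
Proof.
move=> a0 cf cg fg; by apply: le_Rintegral => //; exact: cont_pos_integrable.
Qed.

Lemma tint_ge0 a b f : (forall t, a <= t <= b -> 0 <= f t) -> 0 <= tint a b f.
Proof. by move=> f0; apply: Rintegral_ge0 => t /=; rewrite in_itv/=; exact: f0. Qed.

Lemma tintD a b f g : 0 < a -> cont_pos f -> cont_pos g ->
  tint a b (fun t => f t + g t) = tint a b f + tint a b g.
Proof. by move=> a0 cf cg; rewrite /tint RintegralD//; exact: cont_pos_integrable. Qed.

Lemma tintZ a b c f : 0 < a -> cont_pos f ->
  tint a b (fun t => c * f t) = c * tint a b f.
Proof. by move=> a0 cf; rewrite /tint RintegralZl//; exact: cont_pos_integrable. Qed.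

Lemma tint_cst a b c : a <= b -> tint a b (fun=> c) = c * (b - a).
Proof.
move=> ab; rewrite /tint Rintegral_cst//= lebesgue_measure_itv/= lte_fin.
by have [//|] := ltrP a b; move=> ba; have -> : b = a by [lra]; rewrite subrr.
Qed.

Lemma tint_sum (I : Type) (s : seq I) a b (F : I -> R -> R) : 0 < a ->
  (forall i, cont_pos (F i)) ->
  tint a b (fun t => \sum_(i <- s) F i t) = \sum_(i <- s) tint a b (F i).
Proof.
move=> a0 cF; elim: s => [|i s IH].
  rewrite big_nil; under eq_tint do rewrite big_nil.
  have [ab|ba] := leP a b; first by rewrite tint_cst ?mul0r.
  by rewrite /tint set_itv_ge ?Rintegral_set0// bnd_simp -ltNge.
rewrite big_cons -IH -tintD//; last exact: cont_pos_sum.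
by apply: eq_tint => t _; rewrite big_cons.
Qed.

Lemma tint_cat a b c f : 0 < a -> a <= b -> b <= c -> cont_pos f ->
  tint a b f + tint b c f = tint a c f.
Proof.
move=> a0 ab bc cf.
have icf := cont_pos_integrable c a0 cf.
have := @Rintegral_itvB R f (BLeft a) (BRight c) b icf.
rewrite !bnd_simp => /(_ ab bc).
rewrite Rintegral_itv_obnd_cbnd; last first.
  by apply: (integrableS _ _ _ icf) => //; apply: subset_itvr; rewrite bnd_simp.
by rewrite /tint => <-; rewrite addrC subrK.
Qed.

Lemma tint_le_itv a b c d f : 0 < a -> a <= b -> b <= c -> c <= d ->
  cont_pos f -> (forall t, 0 < t -> 0 <= f t) -> tint b c f <= tint a d f.
Proof.
move=> a0 ab bc cd cf f0.
rewrite -(@tint_cat a b d)//; last lra.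
rewrite -(@tint_cat b c d)//; last lra.
have h1 : 0 <= tint a b f.
  by apply: tint_ge0 => t /andP[? _]; apply: f0; lra.
have h2 : 0 <= tint c d f by apply: tint_ge0 => t /andP[? _]; apply: f0; lra.
lra.
Qed.

Lemma tint_derive a b F f : 0 < a -> a <= b -> cont_pos f ->
  (forall t, 0 < t -> is_derive t 1 F (f t)) -> tint a b f = F b - F a.
Proof.
move=> a0; rewrite le_eqVlt => /predU1P[<- _ _|ab cf dF].
  by rewrite /tint set_itv1 Rintegral_set1 subrr.
have cF : cont_pos F.
  by move=> t t0; apply/differentiable_continuous/derivable1_diffP; apply: ex_derive; exact: dF.
rewrite /tint /Rintegral (@continuous_FTC2 R f F)//.
- apply: continuous_in_subspaceT => t; rewrite inE/= in_itv/= => /andP[? _].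
  by apply: cf; lra.
- split.
  + move=> t; rewrite in_itv/= => /andP[? _].
    by apply: ex_derive; apply: dF; lra.
  + by apply: cvg_at_right_filter; apply: cF.
  + by apply: cvg_at_left_filter; apply: cF; lra.
- move=> t; rewrite in_itv/= => /andP[? _].
  rewrite derive1E; apply: derive_val; apply: dF; lra.
Qed.

Lemma cont_pos_derive F f : (forall t, 0 < t -> is_derive t 1 F (f t)) -> cont_pos F.
Proof.
move=> DF t t0; apply/differentiable_continuous/derivable1_diffP.
by apply: ex_derive; exact: DF.
Qed.

(** At a zero of [f] the exponent function itself is not continuous, since it
    takes the value 1 on negative numbers; the sign of [f] is what saves the
    statement there. *)
Lemma cont_pos_powR q f : 0 < q -> (forall t, 0 < t -> 0 <= f t) ->
  cont_pos f -> cont_pos (fun t => f t `^ q).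
Proof.
move=> q0 f0 cf t t0; have := f0 _ t0; rewrite le_eqVlt => /predU1P[ft|ft].
  apply/cvgrPdist_le => e e0.
  rewrite -ft powR0 ?gt_eqF//.
  have e1 : 0 < e `^ q^-1 by rewrite powR_gt0.
  have := cf _ t0 => /cvgrPdist_le /(_ _ e1).
  rewrite -ft => H; near=> s.
  have s0 : 0 < s by near: s; exact: lt_nbhsr.
  rewrite sub0r normrN ger0_norm ?powR_ge0//.
  have : `|0 - f s| <= e `^ q^-1 by near: s.
  rewrite sub0r normrN ger0_norm ?f0// => fs.
  apply: (@le_trans _ _ ((e `^ q^-1) `^ q)).
    by rewrite ge0_ler_powR ?nnegrE ?f0 ?powR_ge0// ltW.
  by rewrite -powRrM mulVf ?gt_eqF// powRr1// ltW.
apply: (@continuous_comp _ _ _ f (fun x => x `^ q)); first exact: cf.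
apply/differentiable_continuous/derivable1_diffP.
by apply: ex_derive; exact: is_derive1_powR.
Unshelve. all: by end_near. Qed.

Lemma tint_gt0 a b t f : 0 < a -> a < t -> t <= b -> cont_pos f ->
  (forall t, 0 < t -> 0 <= f t) -> 0 < f t -> 0 < tint a b f.
Proof.
move=> a0 at_ tb cf f0 ft.
have t0 : 0 < t by lra.
have ft2 : 0 < f t / 2 by lra.
have := cf _ t0 => /cvgrPdist_lt /(_ _ ft2) /nbhs_ballP[e/= e0 He].
pose d := Num.min (e / 2) (t - a).
have d0 : 0 < d by rewrite lt_min; apply/andP; split; lra.
have de : d < e by rewrite gt_min; apply/orP; left; lra.
have da : d <= t - a by rewrite ge_min lexx orbT.
apply: (@lt_le_trans _ _ (tint (t - d) t f)); last first.
  by apply: tint_le_itv => //; lra.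
apply: (@lt_le_trans _ _ (tint (t - d) t (fun=> f t / 2))).
  by rewrite tint_cst; [rewrite mulr_gt0//; lra|lra].
apply: le_tint => //; [lra|exact: cont_pos_cst|].
move=> s /andP[s1 s2]; have : ball t e s.
  rewrite /ball/= ger0_norm; lra.
by move/He => /=; move/ltr_normlW; lra.
Qed.

End TimeIntegral.

(** * The nonlinear test profile *)

Section TestProfile.
Context {R : realType}.
Variables (a K : R).
Hypotheses (a_gt0 : 0 < a) (a_lt1 : a < 1) (K_gt0 : 0 < K).
Let params : [/\ 0 < a, a < 1 & 0 < K]. Proof. by []. Qed.
Ltac hlra := case: params => ? ? ?; lra.
Ltac hnra := case: params => ? ? ?; nra.
Implicit Types (u w zeta chi xi : R).

Definition level (u : R) : R := 1 + u / K.

(** The coefficient of [zeta] vanishes at [u = 0] and tends to 1, so that the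
    metric cutoff acts only where [u] is at least comparable with [K]; the
    coefficient of [chi ^+ 2] decays, so that the potential acts only where [u]
    is at most comparable with [K].  The term [level u `^ (- a)] has a slope that
    decays slowly enough for the flux bound below to involve the power 1 + a
    only. *)
Definition profile zeta chi u : R :=
  zeta * (1 + level u `^ (- a) - 2 / level u) + 2 * chi ^+ 2 / level u.

(** The primitive in [u], vanishing at [u = 0], of [profile]. *)
Definition profile_int zeta chi u : R :=
  zeta * (u + K * (level u `^ (1 - a) - 1) / (1 - a) - 2 * K * ln (level u))
  + 2 * chi ^+ 2 * K * ln (level u).

Lemma level_ge1 u : 0 <= u -> 1 <= level u.
Proof. by move=> u0; rewrite lerDl divr_ge0// ltW. Qed.

Lemma level_gt0 u : 0 <= u -> 0 < level u.
Proof. by move/level_ge1; lra. Qed.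

Lemma level_powN_ge u : 0 <= u -> (level u)^-1 <= level u `^ (- a).
Proof.
move=> u0; rewrite -powR_inv1 ?(ltW (level_gt0 u0))//.
by rewrite ler_powR ?level_ge1//; hlra.
Qed.

Lemma level_powN_le1 u (b : R) : 0 <= b -> 0 <= u -> level u `^ (- b) <= 1.
Proof.
by move=> b0 u0; rewrite -(powRr0 (level u)) ler_powR ?level_ge1//; lra.
Qed.

Lemma level_inv_le1 u : 0 <= u -> (level u)^-1 <= 1.
Proof. by move=> u0; rewrite invf_le1 ?level_gt0// level_ge1. Qed.

Lemma flux_coef_ge0 u : 0 <= u -> 0 <= 1 + level u `^ (- a) - 2 / level u.
Proof. by move=> u0; have := level_powN_ge u0; have := level_inv_le1 u0; hlra. Qed.

Lemma flux_coef_le u w : 0 <= u -> u <= w ->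
  1 + level u `^ (- a) - 2 / level u <= 2 * (w / K / level w).
Proof.
move=> u0 uw; have w0 : 0 <= w by hlra.
have h1 := level_powN_le1 (ltW a_gt0) u0.
have h2 : (level w)^-1 <= (level u)^-1.
  by rewrite lef_pV2 ?posrE ?level_gt0// lerD2l ler_pM2r ?invr_gt0.
have -> : w / K / level w = 1 - (level w)^-1.
  by rewrite /level; field; rewrite gt_eqF//=; hlra.
hlra.
Qed.

Lemma profile_ge_zeta zeta chi u : 0 <= zeta -> zeta <= chi ^+ 2 -> 0 <= u ->
  zeta <= profile zeta chi u.
Proof.
move=> z0 zc u0; rewrite /profile.
have := powR_ge0 (level u) (- a); have : 0 < (level u)^-1 by rewrite invr_gt0 level_gt0.
hnra.
Qed.

Lemma profile_ge_chi zeta chi u : 0 <= zeta -> 0 <= u ->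
  2 * chi ^+ 2 / level u <= profile zeta chi u.
Proof. by move=> z0 u0; rewrite lerDr mulr_ge0// flux_coef_ge0. Qed.

Lemma profile_le2 zeta chi u : 0 <= zeta -> zeta <= chi ^+ 2 -> chi ^+ 2 <= 1 ->
  0 <= u -> profile zeta chi u <= 2.
Proof.
move=> z0 zc c1 u0; rewrite /profile.
have := level_powN_le1 (ltW a_gt0) u0; have := level_inv_le1 u0.
have : 0 < (level u)^-1 by rewrite invr_gt0 level_gt0.
hnra.
Qed.

Lemma profile_int_ge0 zeta chi u : 0 <= zeta -> zeta <= chi ^+ 2 -> 0 <= u ->
  0 <= profile_int zeta chi u.
Proof.
move=> z0 zc u0; rewrite /profile_int.
have h1 : 1 <= level u `^ (1 - a).
  by rewrite -{1}(powRr0 (level u)) ler_powR ?level_ge1//; hlra.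
have h2 : 0 <= K * ln (level u).
  by rewrite mulr_ge0 ?(ltW K_gt0)// ln_ge0// level_ge1.
have h3 : 0 <= K * (level u `^ (1 - a) - 1) / (1 - a).
  by rewrite divr_ge0 ?mulr_ge0//; hlra.
rewrite -!mulrA; hnra.
Qed.

Lemma profile_int_le q zeta chi u : 1 < q -> 0 <= zeta -> 0 <= u ->
  profile_int zeta chi u <=
  2 * (zeta * u) + 2 * (q / (q - 1)) * (chi ^+ 2 * (u * level u `^ (- q^-1))).
Proof.
move=> q1 z0 u0; rewrite /profile_int.
have h2 : 0 <= K * ln (level u).
  by rewrite mulr_ge0 ?(ltW K_gt0)// ln_ge0// level_ge1.
have h1 : K * (level u `^ (1 - a) - 1) / (1 - a) <= u.
  rewrite ler_pdivrMr ?subr_gt0//.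
  have := @powR_bernoulli R (1 - a) (level u).
  rewrite {3}/level => /(_ _ _ (level_gt0 u0)) h.
  have {}h : level u `^ (1 - a) - 1 <= (1 - a) * (u / K).
    by have := h ltac:(hlra) ltac:(hlra); hlra.
  have -> : u * (1 - a) = K * ((1 - a) * (u / K)) by field; rewrite gt_eqF.
  by rewrite ler_pM2l.
have h3 : K * ln (level u) <= (q / (q - 1)) * (u * level u `^ (- q^-1)).
  have := ln_le_powR q1 (level_ge1 u0); rewrite {2}/level (addrC 1) addrK => h.
  apply: (@le_trans _ _ (K * (q / (q - 1) * (u / K * level u `^ (- q^-1))))).
    by rewrite ler_pM2l.
  by rewrite le_eqVlt; apply/orP; left; apply/eqP; field; rewrite gt_eqF//=; hlra.
have := sqr_ge0 chi => c0.
have h4 := ler_wpM2l c0 h3.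
rewrite -!mulrA in h4 *; hnra.
Qed.

Lemma is_derive_profile_int zeta chi (f : R -> R) (t df : R) :
  0 <= f t -> is_derive t 1 f df ->
  is_derive t 1 (fun s => profile_int zeta chi (f s)) (profile zeta chi (f t) * df).
Proof.
move=> f0 Df; have v0 := level_gt0 f0.
have Dv : is_derive t 1 (fun s => level (f s)) (df / K).
  rewrite /level; apply: is_derive_eq; rewrite /GRing.scale/=.
  by ring.
have Dl : is_derive t 1 (fun s => ln (level (f s))) ((level (f t))^-1 * (df / K)).
  exact: (is_derive1_comp (g := fun s => level (f s)) (x := t) (is_derive1_ln v0) Dv).
have Dp : is_derive t 1 (fun s => level (f s) `^ (1 - a))
   ((1 - a) * level (f t) `^ (- a) * (df / K)).
  have H := is_derive1_powR (1 - a) v0.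
  have {}H : is_derive (level (f t)) 1 (fun x : R => x `^ (1 - a)) ((1 - a) * level (f t) `^ (- a)).
    by apply: is_derive_eq; congr (_ * _ `^ _); ring.
  exact: (is_derive1_comp (g := fun s => level (f s)) (x := t) H Dv).
rewrite /profile_int; apply: is_derive_eq.
rewrite /profile /GRing.scale/=; field.
by rewrite !gt_eqF//= ?v0; hlra.
Qed.

Lemma sub_expr_le n xi xj : 0 <= xj -> xj <= xi ->
  xi ^+ n.+1 - xj ^+ n.+1 <= n.+1%:R * xi ^+ n * (xi - xj).
Proof.
move=> j0 ji; rewrite subrXX mulrC ler_wpM2r ?subr_ge0//.
apply: (@le_trans _ _ (\sum_(i < n.+1) xi ^+ n)); last first.
  by rewrite sumr_const card_ord mulr_natl.
apply: ler_sum => i _; rewrite succnK.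
have -> : xi ^+ n = xi ^+ (n - i) * xi ^+ i by rewrite -exprD subnK// -ltnS.
rewrite ler_wpM2l ?exprn_ge0//; first lra.
by apply: lerXn2r; rewrite ?nnegrE//; lra.
Qed.

(** Where [chi = 1] at both ends, the decrease of the profile in [u] yields a
    negative term quadratic in [u - w], and the variation of [xi] a term linear
    in [u - w] with coefficient at most [2 (u/K) / v]; completing the square
    leaves the right-hand side. *)
Lemma profile_flux_inner n xi xj u w : 0 <= xi -> xi <= 1 -> 0 <= xj ->
  0 <= w -> w <= u ->
  (level u - level w) * (profile (xi ^+ n.+2) 1 u - profile (xj ^+ n.+2) 1 w) <=
  n.+2%:R ^+ 2 / a * ((u / K) `^ (1 + a) * xi ^+ n * (xi - xj) ^+ 2).
Proof.
move=> i0 i1 j0 w0 wu; have u0 : 0 <= u by lra.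
have vu := level_gt0 u0; have vw := level_gt0 w0.
have d0 : 0 <= level u - level w.
  by rewrite subr_ge0 lerD2l ler_pM2r ?invr_gt0.
set d := level u - level w in d0 *.
have A0 := flux_coef_ge0 w0; have A1 := flux_coef_le w0 wu.
have tg := powRN_tangent (ltW a_gt0) vw (ltac:(rewrite -subr_ge0; exact: d0)).
have iw : (level u)^-1 <= (level w)^-1 by rewrite lef_pV2// -subr_ge0.
have z0 : 0 <= u / K by rewrite divr_ge0// ltW.
have zz : 0 <= u / K / level u by rewrite divr_ge0// ltW.
have p0 := powR_ge0 (u / K) (1 + a).
have xn0 : 0 <= xi ^+ n by rewrite exprn_ge0.
have xn2 : 0 <= xi ^+ n.+2 by rewrite exprn_ge0.
have xn1 : xi ^+ n.+2 <= 1 by rewrite exprn_ile1.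
have rhs0 : 0 <= n.+2%:R ^+ 2 / a * ((u / K) `^ (1 + a) * xi ^+ n * (xi - xj) ^+ 2).
  rewrite mulr_ge0 ?divr_ge0 ?sqr_ge0 ?(ltW a_gt0)//.
  by rewrite mulr_ge0 ?sqr_ge0// mulr_ge0.
have -> : profile (xi ^+ n.+2) 1 u - profile (xj ^+ n.+2) 1 w =
  (xi ^+ n.+2 - xj ^+ n.+2) * (1 + level w `^ (- a) - 2 / level w)
  - xi ^+ n.+2 * (level w `^ (- a) - level u `^ (- a))
  - 2 * (1 - xi ^+ n.+2) * ((level w)^-1 - (level u)^-1).
  by rewrite /profile; ring.
set P := level u `^ (- a - 1) in tg.
have P0 : 0 <= P by rewrite powR_ge0.
have step1 : 0 <= xi ^+ n.+2 * (level w `^ (- a) - level u `^ (- a)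
   - a * P * d) by rewrite mulr_ge0// subr_ge0.
have step2 : 0 <= 2 * (1 - xi ^+ n.+2) * ((level w)^-1 - (level u)^-1).
  by rewrite mulr_ge0 ?subr_ge0// mulr_ge0// subr_ge0.
have aP : 0 <= a * P by rewrite mulr_ge0// ltW.
have [ij|ji] := leP xi xj.
  have : xi ^+ n.+2 <= xj ^+ n.+2 by apply: lerXn2r; rewrite ?nnegrE.
  move=> xx; apply: le_trans rhs0.
  rewrite -oppr_ge0 -mulrN mulr_ge0//.
  have s3 : 0 <= (xj ^+ n.+2 - xi ^+ n.+2) * (1 + level w `^ (- a) - 2 / level w).
    by rewrite mulr_ge0// subr_ge0.
  have : 0 <= xi ^+ n.+2 * (a * P * d) by rewrite mulr_ge0// mulr_ge0.
  lra.
pose N : R := n.+2%:R; pose e := xi - xj.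
have e0 : 0 <= e by rewrite subr_ge0 ltW.
have N0 : 0 <= N by rewrite ler0n.
pose s := N * e * (u / K / level u).
have s0 : 0 <= s by rewrite /s mulr_ge0// mulr_ge0.
have step3 : (xi ^+ n.+2 - xj ^+ n.+2) * (1 + level w `^ (- a) - 2 / level w)
    <= xi ^+ n.+1 * (2 * s).
  apply: (@le_trans _ _ ((N * xi ^+ n.+1 * e) * (2 * (u / K / level u)))).
    apply: ler_pM => //.
      by rewrite subr_ge0; apply: lerXn2r; rewrite ?nnegrE// ltW.
    by apply: sub_expr_le => //; exact: ltW.
  by rewrite le_eqVlt; apply/orP; left; apply/eqP; rewrite /s; ring.
have step4 : s ^+ 2 <= N ^+ 2 * e ^+ 2 * ((u / K) `^ (1 + a) * P).
  rewrite /s exprMn exprMn ler_wpM2l//; first by rewrite mulr_ge0 ?sqr_ge0.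
  rewrite exprMn exprVn ler_pdivrMr ?exprn_gt0// -mulrA.
  have -> : P * level u ^+ 2 = level u `^ (1 - a).
    rewrite -(powR_mulrn 2 (ltW vu)) -powRD; last by rewrite (gt_eqF vu) implybT.
    by congr (_ `^ _); ring.
  have := @sqr_le_powR R (1 + a) (u / K).
  have -> : 2 - (1 + a) = 1 - a by ring.
  by apply => //; hlra.
(* completing the square in d *)
have step5 : d * (xi ^+ n.+1 * (2 * s) - xi ^+ n.+2 * (a * P * d)) * (a * P) <=
   xi ^+ n * s ^+ 2.
  have -> : d * (xi ^+ n.+1 * (2 * s) - xi ^+ n.+2 * (a * P * d)) * (a * P)
    = xi ^+ n * (s ^+ 2 - (s - xi * (a * P * d)) ^+ 2) by rewrite !exprS; ring.
  by rewrite ler_wpM2l// gerBl sqr_ge0.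
have P1 : 0 < P by rewrite powR_gt0.
have aP1 : 0 < a * P by rewrite mulr_gt0.
rewrite -(ler_pM2r aP1).
apply: (@le_trans _ _ (d * (xi ^+ n.+1 * (2 * s) - xi ^+ n.+2 * (a * P * d)) * (a * P))).
  rewrite ler_pM2r// ler_wpM2l//; lra.
apply: le_trans step5 _.
apply: (@le_trans _ _ (xi ^+ n * (N ^+ 2 * e ^+ 2 * ((u / K) `^ (1 + a) * P)))).
  by rewrite ler_wpM2l.
rewrite le_eqVlt; apply/orP; left; apply/eqP; rewrite /N /e; field.
by rewrite gt_eqF.
Qed.

(** Off the region where [chi = 1] the metric cutoff vanishes, so each end of
    the edge either lies in that region or carries the potential only.  The
    bound involves the larger value [u] alone, whatever the ratio of [u] to [w]:
    this takes the place of the chain rule. *)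
Lemma profile_flux n xi xj ci cj u w : 0 <= xi -> xi <= 1 -> 0 <= xj -> xj <= 1 ->
  (xi != 0 -> ci = 1) -> (xj != 0 -> cj = 1) ->
  0 <= w -> w <= u ->
  (level u - level w) * (profile (xi ^+ n.+2) ci u - profile (xj ^+ n.+2) cj w) <=
  2 * (ci - cj) ^+ 2 +
  (2 + n.+2%:R ^+ 2 / a) * ((u / K) `^ (1 + a) * xi ^+ n * (xi - xj) ^+ 2).
Proof.
move=> i0 i1 j0 j1 ic jc w0 wu; have u0 : 0 <= u by lra.
have vu := level_gt0 u0; have vw := level_gt0 w0.
have d0 : 0 <= level u - level w.
  by rewrite subr_ge0 lerD2l ler_pM2r ?invr_gt0.
have z0 : 0 <= u / K by rewrite divr_ge0// ltW.
set Q := (u / K) `^ (1 + a) * xi ^+ n * (xi - xj) ^+ 2.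
have Q0 : 0 <= Q.
  by rewrite mulr_ge0 ?sqr_ge0// mulr_ge0 ?powR_ge0 ?exprn_ge0.
have na0 : 0 <= n.+2%:R ^+ 2 / a by rewrite divr_ge0 ?sqr_ge0// ltW.
have cc := sqr_ge0 (ci - cj).
have res := resistor_ineq ci cj vu vw.
have naQ : 0 <= n.+2%:R ^+ 2 / a * Q by rewrite mulr_ge0.
(* if x carries the potential only, the term of zeta at y has the good sign *)
have [xi0|/ic ci1] := eqVneq xi 0.
  apply: (@le_trans _ _ (2 * (ci - cj) ^+ 2)); last first.
    by rewrite lerDl mulr_ge0// addr_ge0.
  apply: (@le_trans _ _ (2 * ((level u - level w) *
     (ci ^+ 2 / level u - cj ^+ 2 / level w)))); last by rewrite ler_pM2l.
  rewrite mulrCA ler_wpM2l// {1}/profile xi0 expr0n mul0r add0r.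
  have := @profile_ge_chi (xj ^+ n.+2) cj w (exprn_ge0 _ j0) w0; lra.
have [xj0|/jc cj1] := eqVneq xj 0; last first.
  have := profile_flux_inner n i0 i1 j0 w0 wu.
  rewrite ci1 cj1 -/Q subrr expr0n mulr0 add0r; lra.
have -> : profile (xi ^+ n.+2) ci u - profile (xj ^+ n.+2) cj w =
   xi ^+ n.+2 * (1 + level u `^ (- a) - 2 / level u) +
   2 * (ci ^+ 2 / level u - cj ^+ 2 / level w).
  by rewrite /profile xj0 expr0n mul0r; ring.
have A1 := flux_coef_le u0 (lexx u).
have A0 := flux_coef_ge0 u0.
(* here zeta vanishes at y, and zeta itself at x is part of the gradient *)
have dz : level u - level w <= u / K.
  have : 0 <= w / K by rewrite divr_ge0// ltW.
  by rewrite /level; lra.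
have sq := @sqr_div_le_powR R (1 + a) (u / K).
have {}sq : (u / K) ^+ 2 / level u <= (u / K) `^ (1 + a) by apply: sq => //; hlra.
have xn0 : 0 <= xi ^+ n.+2 by rewrite exprn_ge0.
have main : (level u - level w) * (xi ^+ n.+2 *
    (1 + level u `^ (- a) - 2 / level u)) <= 2 * Q.
  apply: (@le_trans _ _ (u / K * (xi ^+ n.+2 * (2 * (u / K / level u))))).
    by apply: ler_pM => //; [rewrite mulr_ge0|rewrite ler_wpM2l].
  have -> : u / K * (xi ^+ n.+2 * (2 * (u / K / level u))) =
    2 * xi ^+ n.+2 * ((u / K) ^+ 2 / level u) by ring.
  have -> : 2 * Q = 2 * xi ^+ n.+2 * ((u / K) `^ (1 + a)).
    by rewrite /Q xj0 subr0 !exprS; ring.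
  by rewrite ler_wpM2l// mulr_ge0.
by rewrite mulrDr; lra.
Qed.

End TestProfile.

(** * Finite sums and Green's formula on a locally finite graph *)

Lemma fsbig_seq_support (R : realType) (V : choiceType) (P : set V) (W : seq V)
  (F : V -> R) : uniq W -> (forall y, ~ P y -> F y = 0) ->
  (forall y, y \notin W -> F y = 0) ->
  \sum_(y \in P) F y = \sum_(y <- W) F y.
Proof.
move=> uW FP FW; rewrite (fsbig_widen P setT)//; last by move=> y [_ /FP].
transitivity (\sum_(y \in [set` W]) F y); last exact/esym/fsbig_seq.
by apply/esym/fsbig_widen => // y [_ /negP/FW].
Qed.

Lemma eq_big_seq_support (R : realType) (V : choiceType) (B W : seq V)
  (F : V -> R) : uniq B -> uniq W -> {subset B <= W} ->
  (forall y, y \notin B -> F y = 0) ->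
  \sum_(y <- B) F y = \sum_(y <- W) F y.
Proof.
move=> uB uW BW FB; transitivity (\sum_(y \in [set` B]) F y); first exact: fsbig_seq.
apply: fsbig_seq_support => //.
- by move=> y /negP/FB.
- by move=> y yW; apply: FB; apply: contra yW => /BW.
Qed.

Lemma ler_sum_subset (R : realType) (V : choiceType) (B W : seq V) (F H : V -> R) :
  uniq B -> uniq W -> {subset B <= W} ->
  (forall y, y \in B -> F y <= H y) -> (forall y, y \in W -> 0 <= H y) ->
  \sum_(y <- B) F y <= \sum_(y <- W) H y.
Proof.
move=> uB uW BW FH H0.
have -> : \sum_(y <- B) F y = \sum_(y <- B) (if y \in B then F y else 0).
  by apply: eq_big_seq => y ->.
rewrite (eq_big_seq_support uB uW BW); last by move=> y /negbTE ->.
rewrite big_seq [leRHS]big_seq; apply: ler_sum => y yW.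
by case: ifP => [/FH|_]//; exact: H0.
Qed.

Section GraphCalculus.
Context {R : realType} {V : choiceType} (G : weighted_graph R V).
Implicit Types (x y : V) (f g u : V -> R).

Definition nbr_sum x f : R := \sum_(y \in nbrs G x) weight G x y * f y.

Lemma weight_ge0 x y : 0 <= weight G x y.
Proof.
by case: (boolP (adj G x y)) => [/weight_gt0/ltW|/weight_eq0 ->].
Qed.

Lemma nbr_sumE (W : seq V) x f : uniq W ->
  (forall y, y \notin W -> weight G x y * f y = 0) ->
  nbr_sum x f = \sum_(y <- W) weight G x y * f y.
Proof.
move=> uW fW; apply: fsbig_seq_support => // y /negP/weight_eq0 ->.
by rewrite mul0r.
Qed.

Lemma nbr_sum_fset x f :
  nbr_sum x f = \sum_(y <- fset_set (nbrs G x)) weight G x y * f y.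
Proof.
apply: nbr_sumE => // y; rewrite in_fset_set; last exact: locally_finite.
by rewrite notin_setE/= => /negP/weight_eq0 ->; rewrite mul0r.
Qed.

Lemma nbr_sum_ge0 x f : (forall y, adj G x y -> 0 <= f y) -> 0 <= nbr_sum x f.
Proof.
move=> f0; rewrite nbr_sum_fset; apply: sumr_ge0 => y _.
case: (boolP (adj G x y)) => [xy|/weight_eq0->]; last by rewrite mul0r.
by rewrite mulr_ge0 ?weight_ge0// f0.
Qed.

Lemma ler_nbr_sum x f g : (forall y, adj G x y -> f y <= g y) ->
  nbr_sum x f <= nbr_sum x g.
Proof.
move=> fg; rewrite !nbr_sum_fset; apply: ler_sum => y _.
case: (boolP (adj G x y)) => [xy|/weight_eq0->]; last by rewrite !mul0r.
by rewrite ler_wpM2l ?weight_ge0// fg.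
Qed.

Lemma nbr_sumZ x (c : R) f : nbr_sum x (fun y => c * f y) = c * nbr_sum x f.
Proof. by rewrite !nbr_sum_fset mulr_sumr; apply: eq_bigr => y _; rewrite mulrCA. Qed.

Lemma nbr_sum_sum (I : Type) (s : seq I) x (F : I -> V -> R) :
  nbr_sum x (fun y => \sum_(i <- s) F i y) = \sum_(i <- s) nbr_sum x (F i).
Proof.
rewrite nbr_sum_fset; under eq_bigr do rewrite mulr_sumr.
by rewrite exchange_big/=; apply: eq_bigr => i _; rewrite nbr_sum_fset.
Qed.

(** All the finite sums over pairs of vertices below run over such a set [W]:
    functions supported in [B] have their edge differences supported in it. *)
Definition closed_hull (B W : seq V) : Prop :=
  {subset B <= W} /\ forall x y, x \in B -> adj G x y -> y \in W.

Lemma exists_hull (B : seq V) : exists2 W : seq V, uniq W & closed_hull B W.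
Proof.
have fW : finite_set ([set` B] `|` \bigcup_(x in [set` B]) nbrs G x).
  rewrite finite_setU; split => //.
  by apply: bigcup_finite => // x _; exact: locally_finite.
exists (fset_set ([set` B] `|` \bigcup_(x in [set` B]) nbrs G x)) => //; split.
  by move=> x xB; rewrite in_fset_set//; apply/mem_set; left.
by move=> x y xB xy; rewrite in_fset_set//; apply/mem_set; right; exists x.
Qed.

Lemma energy_ge0 f : 0 <= energy G f.
Proof.
rewrite mulr_ge0 ?invr_ge0//; apply: fsumr_ge0 => x _.
by apply: fsumr_ge0 => y _; rewrite mulr_ge0 ?weight_ge0 ?sqr_ge0.
Qed.

Lemma energyE (B W : seq V) f : uniq W -> closed_hull B W ->
  (forall x, x \notin B -> f x = 0) ->
  energy G f = 2^-1 * \sum_(x <- W) \sum_(y <- W) weight G x y * (f x - f y) ^+ 2.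
Proof.
move=> uW [BW nW] fB; rewrite /energy; congr (_ * _).
have inner x : x \in W -> \sum_(y \in nbrs G x) weight G x y * (f x - f y) ^+ 2 =
   \sum_(y <- W) weight G x y * (f x - f y) ^+ 2.
  move=> xW; apply: (@nbr_sumE W x (fun y => (f x - f y) ^+ 2)) => // y yW.
  have [xB|/fB fx0] := boolP (x \in B).
    by rewrite weight_eq0 ?mul0r//; apply: contra yW; exact: nW.
  have /fB fy0 : y \notin B by apply: contra yW => /BW.
  by rewrite fx0 fy0 subrr expr0n mulr0.
rewrite (@fsbig_seq_support _ _ _ W)//; last first.
  move=> x xW; apply: fsbig1 => y /= xy.
  have /fB -> : x \notin B by apply: contra xW => /BW.
  have /fB -> : y \notin B.
    by apply: contra xW => yB; apply: (nW y) => //; rewrite adj_sym.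
  by rewrite subrr expr0n mulr0.
  by move=> x /(_ I).
by apply: eq_big_seq => x; exact: inner.
Qed.

Lemma green (B W : seq V) u f : uniq B -> uniq W -> closed_hull B W ->
  (forall x, x \notin B -> f x = 0) ->
  \sum_(x <- B) f x * nbr_sum x (fun y => u y - u x) =
  - (2^-1 * \sum_(x <- W) \sum_(y <- W)
      weight G x y * ((u x - u y) * (f x - f y))).
Proof.
move=> uB uW [BW nW] fB.
rewrite (@eq_big_seq_support _ _ B W)//; last by move=> y /fB ->; rewrite mul0r.
have -> : \sum_(x <- W) f x * nbr_sum x (fun y => u y - u x) =
    \sum_(x <- W) \sum_(y <- W) weight G x y * (f x * (u y - u x)).
  apply: eq_bigr => x _.
  have [xB|/fB fx0] := boolP (x \in B); last first.
    by rewrite fx0 mul0r big1// => y _; rewrite mul0r mulr0.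
  rewrite (@nbr_sumE W)//; last first.
    by move=> y yW; rewrite weight_eq0 ?mul0r//; apply: contra yW; exact: nW.
  by rewrite mulr_sumr; apply: eq_bigr => y _; rewrite mulrCA.
set S := LHS.
have S' : S = \sum_(x <- W) \sum_(y <- W) weight G x y * (f y * (u x - u y)).
  rewrite /S exchange_big/=; apply: eq_bigr => x _; apply: eq_bigr => y _.
  by rewrite weight_sym.
have -> : \sum_(x <- W) \sum_(y <- W) weight G x y * ((u x - u y) * (f x - f y))
   = - S - S.
  rewrite {1}/S S' -!sumrN -big_split/=; apply: eq_bigr => x _.
  rewrite -!sumrN -big_split/=; apply: eq_bigr => y _; ring.
by field.
Qed.

End GraphCalculus.

(** * Flux of the test profile *)

Section ProfileFlux.
Context {R : realType} {V : choiceType} (G : weighted_graph R V).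

Definition grad2 (xi : V -> R) (x : V) : R :=
  nbr_sum G x (fun y => (xi x - xi y) ^+ 2).

(** After summation by parts the edges contribute separately, and on each of
    them [profile_flux] applies with the larger value of [u] in the first
    place; this is why both ends appear in the bound for one edge. *)
Lemma profile_flux_le (a K : R) (n : nat) (B : seq V) (xi chi u : V -> R) :
  0 < a -> a < 1 -> 0 < K -> (0 < n)%N -> uniq B ->
  (forall x, 0 <= xi x <= 1) -> (forall x, xi x != 0 -> chi x = 1) ->
  (forall x, x \notin B -> chi x = 0) -> (forall x, 0 <= u x) ->
  - (\sum_(x <- B) profile a K (xi x ^+ n.+2) (chi x) (u x) *
        nbr_sum G x (fun y => u y - u x)) <=
  K * (2 * energy G chi + (2 + n.+2%:R ^+ 2 / a) *
     \sum_(x <- B) (u x / K) `^ (1 + a) * xi x ^+ n * grad2 xi x).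
Proof.
move=> a0 a1 K0 n0 uB xi01 xichi chiB u0.
have [W uW hW] := exists_hull G B.
have [BW nW] := hW.
have xiB x : x \notin B -> xi x = 0.
  move=> xB; apply/eqP/negPn/negP => /xichi; rewrite chiB//.
  by move/eqP; rewrite eq_sym oner_eq0.
set C := 2 + _; pose Th x := profile a K (xi x ^+ n.+2) (chi x) (u x).
have ThB x : x \notin B -> Th x = 0.
  move=> xB; rewrite /Th /profile xiB// chiB// !expr0n/=.
  by rewrite mul0r mulr0 mul0r addr0.
rewrite (green _ uB uW hW ThB) opprK.
have edge x y : (u x - u y) * (Th x - Th y) <=
  K * (2 * (chi x - chi y) ^+ 2 + C * ((u x / K) `^ (1 + a) * xi x ^+ n * (xi x - xi y) ^+ 2)
   + C * ((u y / K) `^ (1 + a) * xi y ^+ n * (xi y - xi x) ^+ 2)).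
  have C0 : 0 <= C by rewrite addr_ge0// divr_ge0 ?sqr_ge0// ltW.
  have Q0 z w : 0 <= C * ((u z / K) `^ (1 + a) * xi z ^+ n * (xi z - xi w) ^+ 2).
    have /andP[z0 _] := xi01 z.
    by rewrite mulr_ge0// mulr_ge0 ?sqr_ge0// mulr_ge0 ?powR_ge0 ?exprn_ge0.
  wlog uxy : x y / u y <= u x => [H|].
    have [/H//|/ltW/H] := leP (u y) (u x).
    rewrite -(opprB (u x)) -(opprB (Th x)) mulrNN => h; apply: le_trans h _.
    rewrite ler_pM2l// -(opprB (chi x)) sqrrN; lra.
  have -> : u x - u y = K * (level K (u x) - level K (u y)).
    by rewrite /level; field; rewrite gt_eqF.
  rewrite -mulrA ler_pM2l//.
  have /andP[x0 x1] := xi01 x; have /andP[y0 y1] := xi01 y.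
  have := profile_flux a0 a1 K0 n x0 x1 y0 y1 (@xichi x) (@xichi y) (u0 y) uxy.
  have := Q0 y x; rewrite -/C /Th; lra.
pose S : R := \sum_(x <- W) \sum_(y <- W) weight G x y * (chi x - chi y) ^+ 2.
pose T : R := \sum_(x <- W) \sum_(y <- W)
  weight G x y * ((u x / K) `^ (1 + a) * xi x ^+ n * (xi x - xi y) ^+ 2).
have ES : energy G chi = 2^-1 * S by exact: energyE chiB.
have TE : T = \sum_(x <- B) (u x / K) `^ (1 + a) * xi x ^+ n * grad2 xi x.
  rewrite (@eq_big_seq_support _ _ B W)//; last first.
    by move=> x /xiB ->; rewrite expr0n -[n == 0%N]negbK -lt0n n0 mulr0 mul0r.
  apply: eq_bigr => x _.
  have [xB|/xiB xi0] := boolP (x \in B); last first.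
    rewrite xi0 expr0n -[n == 0%N]negbK -lt0n n0 mulr0 mul0r big1// => y _.
    by rewrite mul0r mulr0.
  rewrite /grad2 (@nbr_sumE _ _ G W)//.
    by rewrite mulr_sumr; apply: eq_bigr => y _; rewrite mulrCA.
  by move=> y yW; rewrite weight_eq0 ?mul0r//; apply: contra yW; exact: nW.
have T' : T = \sum_(x <- W) \sum_(y <- W)
  weight G x y * ((u y / K) `^ (1 + a) * xi y ^+ n * (xi y - xi x) ^+ 2).
  rewrite /T exchange_big/=; apply: eq_bigr => x _; apply: eq_bigr => y _.
  by rewrite weight_sym.
apply: (@le_trans _ _ (2^-1 * (K * (2 * S + C * T + C * T)))); last first.
  by rewrite ES TE; lra.
rewrite ler_pM2l ?invr_gt0// {2}T' !mulrDr !mulr_sumr -!big_split/=.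
apply: ler_sum => x _; rewrite !mulr_sumr -!big_split/=.
apply: ler_sum => y _.
have := ler_wpM2l (weight_ge0 G x y) (edge x y); lra.
Qed.

End ProfileFlux.

(** * Cutoff in time *)

Section TimeCutoff.
Context {R : realType}.
Implicit Types (T t ts : R).

Definition cutoff T t : R := Num.min 1 ((2 * T - t) / T).

Lemma cutoff_eq1 T t : 0 < T -> t <= T -> cutoff T t = 1.
Proof. by move=> T0 tT; apply: min_l; rewrite ler_pdivlMr//; lra. Qed.

Lemma cutoffE T t : 0 < T -> T <= t -> cutoff T t = (2 * T - t) / T.
Proof. by move=> T0 tT; apply: min_r; rewrite ler_pdivrMr//; lra. Qed.

Lemma cutoff01 T t : 0 < T -> t <= 2 * T -> 0 <= cutoff T t <= 1.
Proof.
move=> T0 tT; rewrite le_min ler01/= divr_ge0 ?subr_ge0 ?(ltW T0)//=.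
by rewrite ge_min lexx.
Qed.

Lemma cont_pos_cutoff T n : cont_pos (fun t => cutoff T t ^+ n).
Proof.
have c1 : cont_pos (cutoff T).
  move=> t t0; apply: continuous_min; first exact: cvg_cst.
  apply: continuousM; last exact: cvg_cst.
  by apply: continuousB; [exact: cvg_cst|exact: cvg_id].
exact: cont_posX.
Qed.

(** The cutoff has a kink at [T], so the product rule is integrated separately
    on both sides of [T].  Since the cutoff is 1 at the initial time and [Y] is
    nonnegative there, no initial value of [Y] enters the bound. *)
Lemma time_cutoff_ineq (n : nat) ts T (Y dY X F H : R -> R) :
  0 < ts -> ts <= T ->
  cont_pos dY -> cont_pos X -> cont_pos F -> cont_pos H ->
  (forall t, 0 < t -> is_derive t 1 Y (dY t)) -> 0 <= Y ts ->
  (forall t, ts <= t <= 2 * T ->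
     cutoff T t ^+ n.+1 * X t <= cutoff T t ^+ n.+1 * dY t + F t) ->
  (forall t, T <= t <= 2 * T -> n.+1%:R / T * (cutoff T t ^+ n * Y t) <= H t) ->
  tint ts (2 * T) (fun t => cutoff T t ^+ n.+1 * X t) <=
  tint ts (2 * T) F + tint T (2 * T) H.
Proof.
move=> ts0 tsT cdY cX cF cH DY Y0 XF YH.
have T0 : 0 < T by lra.
have T2 : T <= 2 * T by lra.
have cc := @cont_pos_cutoff T n.+1.
have cY : cont_pos Y.
  exact: cont_pos_derive DY.
have cXc : cont_pos (fun t => cutoff T t ^+ n.+1 * X t) by exact: cont_posM.
rewrite -(tint_cat ts0 tsT T2 cXc) -(tint_cat ts0 tsT T2 cF).
have h1 : tint ts T (fun t => cutoff T t ^+ n.+1 * X t) <= Y T - Y ts + tint ts T F.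
  rewrite -(tint_derive ts0 tsT cdY DY) -tintD//.
  apply: le_tint => //; first exact: cont_posD.
  move=> t /andP[t1 t2]; have := XF t; rewrite (cutoff_eq1 T0 t2) !expr1n !mul1r.
  by apply; lra.
pose z t : R := ((2 * T - t) / T) ^+ n.+1.
pose dz t : R := - (n.+1%:R / T * ((2 * T - t) / T) ^+ n).
have Dz t : is_derive t 1 z (dz t).
  have -> : z = (fun t => (2 * T - t) / T) ^+ n.+1.
    by apply/funext => s; rewrite /z exprfctE.
  apply: is_derive_eq; rewrite /dz /GRing.scale/=.
  by field; rewrite gt_eqF.
have cz : cont_pos z.
  by apply: (@cont_pos_derive _ z dz) => t _; exact: Dz.
have cdz : cont_pos dz.
  have -> : dz = (fun t => (- (n.+1%:R / T)) * ((2 * T - t) / T) ^+ n).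
    by apply/funext => t; rewrite /dz mulNr.
  apply: cont_posZ; apply: cont_posX => t t0.
  apply: continuousM; last exact: cvg_cst.
  by apply: continuousB; [exact: cvg_cst|exact: cvg_id].
have czY : cont_pos (fun t => dz t * Y t + z t * dY t).
  by apply: cont_posD; apply: cont_posM.
have DzY t : 0 < t -> is_derive t 1 (fun t => z t * Y t) (dz t * Y t + z t * dY t).
  move=> t0; have := DY t t0 => ?; have := Dz t => ?.
  by apply: is_derive_eq; rewrite /GRing.scale/= addrC; congr (_ + _); rewrite mulrC.
have h2 := tint_derive T0 T2 czY DzY.
have zE : z (2 * T) * Y (2 * T) - z T * Y T = - Y T.
  rewrite /z subrr mul0r expr0n/= mul0r sub0r; congr (- _).
  by have -> : (2 * T - T) / T = 1 by [field; rewrite gt_eqF]; rewrite expr1n mul1r.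
rewrite {}zE in h2.
have h3 : tint T (2 * T) (fun t => cutoff T t ^+ n.+1 * X t) <=
   - Y T + tint T (2 * T) F + tint T (2 * T) H.
  rewrite -h2 -!tintD//; last exact: cont_posD.
  apply: le_tint => //; first by apply: cont_posD => //; exact: cont_posD.
  move=> t /andP[t1 t2].
  have := XF t; have := YH t; rewrite t1 t2/= (cutoffE T0 t1).
  rewrite (le_trans tsT t1) -/(z t) => /(_ isT) h4 /(_ isT) h5.
  by rewrite /dz mulNr -mulrA; lra.
lra.
Qed.

End TimeCutoff.

(** * Young-type absorption *)

Section MasterPrelim.
Context {R : realType}.

Lemma cont_posV (f : R -> R) : cont_pos f -> (forall t, 0 < t -> f t != 0) ->
  cont_pos (fun t => (f t)^-1).
Proof. by move=> cf f0 t t0; apply: continuousV; [exact: f0|exact: cf]. Qed.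

Lemma cont_pos_profile (a K zeta chi : R) (f : R -> R) : 0 < a -> 0 < K ->
  cont_pos f -> (forall t, 0 < t -> 0 <= f t) ->
  cont_pos (fun t => profile a K zeta chi (f t)).
Proof.
move=> a0 K0 cf f0.
have l0 t : 0 < t -> 0 < level K (f t) by move=> /f0; exact: level_gt0.
have cl : cont_pos (fun t => level K (f t)).
  apply: cont_posD; first exact: cont_pos_cst.
  by apply: cont_posM => //; exact: cont_pos_cst.
have cv : cont_pos (fun t => (level K (f t))^-1).
  by apply: cont_posV => // t /l0 /lt0r_neq0.
have cp : cont_pos (fun t => level K (f t) `^ (- a)).
  under eq_fun do rewrite powRN.
  apply: cont_posV; first by apply: cont_pos_powR => // t /l0 /ltW.
  by move=> t /l0 h; rewrite gt_eqF// powR_gt0.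
apply: cont_posD; last by apply: cont_posZ.
apply: cont_posZ; apply: cont_posD.
  by apply: cont_posD => //; exact: cont_pos_cst.
under eq_fun do rewrite -mulNr; exact: cont_posZ.
Qed.

(** The powers of the cutoff are chosen so that one power may be lost to the
    derivative and still be recovered by raising to the exponent q. *)
Lemma young_cutoff (q w tau beta : R) n : 1 < q -> n.+2%:R <= n.+1%:R * q ->
  0 <= w -> 0 <= tau <= 1 -> 0 <= beta <= 1 ->
  tau ^+ n.+1 * (beta * w) <= 1 + w `^ q * (tau ^+ n.+2 * beta).
Proof.
move=> q1 nq w0 /andP[t0 t1] /andP[b0 b1].
set s := tau ^+ n.+1 * (beta * w).
have tn0 m : 0 <= tau ^+ m by rewrite exprn_ge0.
have bw0 : 0 <= beta * w by rewrite mulr_ge0.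
have s0 : 0 <= s by rewrite mulr_ge0.
apply: (@le_trans _ _ (1 + s `^ q)).
  by rewrite -{1}(powRr1 s0); apply: powR_le1D => //; exact: ltW.
rewrite lerD2l /s powRM// powRM//.
have -> : w `^ q * (tau ^+ n.+2 * beta) = tau ^+ n.+2 * (beta * w `^ q) by ring.
apply: ler_pM; rewrite ?powR_ge0//; first by rewrite mulr_ge0 ?powR_ge0.
  rewrite -!powR_mulrn// -powRrM.
  move: t0; rewrite le_eqVlt => /predU1P[<-|t0].
    rewrite !powR0//; apply/eqP => h; have : (0 : R) < n.+1%:R * q.
      by rewrite mulr_gt0//; lra.
    by rewrite h ltxx.
  by apply: ger_powR => //; rewrite t0.
rewrite ler_wpM2r ?powR_ge0//.
move: b0; rewrite le_eqVlt => /predU1P[<-|b0].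
  by rewrite powR0// gt_eqF//; lra.
by apply: ge1r_powR; [rewrite b0|exact: ltW].
Qed.

(** Two powers of [xi] are lost to the squared gradient; as p < q they are
    recovered once the exponent n is large. *)
Lemma young_gradient (q p w xi : R) n : 0 < p -> p <= q -> (0 < n)%N ->
  n.+2%:R * p <= n%:R * q ->
  0 <= w -> 0 <= xi <= 1 ->
  w `^ p * xi ^+ n <= 1 + w `^ q * xi ^+ n.+2.
Proof.
move=> p0 pq n0 nq w0 /andP[]; rewrite le_eqVlt => /predU1P[<- _|x0 x1].
  by rewrite !expr0n -[n == 0%N]negbK -lt0n n0 /= !mulr0 addr0.
have q0 : 0 < q by lra.
set s := w * xi `^ (n.+2%:R / q).
have s0 : 0 <= s by rewrite mulr_ge0 ?powR_ge0.
apply: (@le_trans _ _ (1 + s `^ q)); last first.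
  by rewrite lerD2l /s powRM ?powR_ge0// -powRrM divfK ?gt_eqF// powR_mulrn// ltW.
apply: le_trans (powR_le1D (ltW p0) pq s0).
rewrite /s powRM ?powR_ge0// ler_wpM2l ?powR_ge0// -powRrM -powR_mulrn ?(ltW x0)//.
apply: ger_powR; first by rewrite x0.
by rewrite mulrAC ler_pdivrMr.
Qed.

(** The flux of the metric cutoff at level [K = lam K0], expressed at the level
    [K0]: the power 1 + a > 1 turns the largeness of [lam] into the gain
    [lam^(-a)]. *)
Lemma flux_young (a q lam K0 e xi u : R) n : 0 < a -> 1 + a <= q -> (0 < n)%N ->
  n.+2%:R * (1 + a) <= n%:R * q -> 0 < lam -> 0 < K0 -> 0 <= e <= 1 ->
  0 <= xi <= 1 -> 0 <= u ->
  e * (lam * K0 * (u / (lam * K0)) `^ (1 + a) * xi ^+ n) <=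
  lam `^ (- a) * K0 * (1 + (u / K0) `^ q * (e * xi ^+ n.+2)).
Proof.
move=> a0 aq n0 nq lam0 K00 /andP[e0 e1] xi01 u0.
have w0 : 0 <= u / K0 by rewrite divr_ge0// ltW.
have -> : lam * K0 * (u / (lam * K0)) `^ (1 + a) =
    lam `^ (- a) * K0 * (u / K0) `^ (1 + a).
  have -> : u / (lam * K0) = (u / K0) * lam^-1 by field; rewrite !gt_eqF.
  rewrite powRM ?invr_ge0 ?(ltW lam0)// -(powR_inv1 (ltW lam0)) -powRrM mulN1r.
  have -> : lam `^ (- a) = lam * lam `^ (- (1 + a)).
    rewrite -{2}(powRr1 (ltW lam0)) -powRD ?(gt_eqF lam0) ?implybT//.
    by congr (_ `^ _); ring.
  by ring.
have p0 : 0 < 1 + a by lra.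
have yg := ler_wpM2l e0 (young_gradient p0 aq n0 nq w0 xi01).
rewrite -(mulrA (lam `^ _ * _)) mulrCA ler_wpM2l//.
  by rewrite mulr_ge0 ?powR_ge0// ltW.
apply: le_trans yg _; rewrite mulrDr mulr1 mulrCA; lra.
Qed.

(** Although the profile is taken at level [K], its primitive is controlled at
    any level [K0], with a constant that does not see the ratio of the two. *)
Lemma profile_int_young (a q K K0 tau zeta chi u : R) n :
  0 < a -> a < 1 -> 0 < K -> 0 < K0 -> 1 < q -> n.+2%:R <= n.+1%:R * q ->
  0 <= tau <= 1 -> 0 <= zeta <= 1 -> chi ^+ 2 <= 1 -> zeta <= chi ^+ 2 ->
  0 <= u ->
  tau ^+ n.+1 * profile_int a K zeta chi u <=
  (2 + 2 * (q / (q - 1))) *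
    (K0 * (1 + (u / K0) `^ q * (tau ^+ n.+2 * profile a K zeta chi u))).
Proof.
move=> a0 a1 KK0 K00 q1 nq t01 z01 c1 zc ux.
have cq0 : 0 <= q / (q - 1) by rewrite divr_ge0; lra.
set cq := q / (q - 1) in cq0 *.
have /andP[z0 _] := z01.
have c01 : 0 <= chi ^+ 2 <= 1 by rewrite sqr_ge0.
have w0 : 0 <= u / K0 by rewrite divr_ge0// ltW.
have tn m : 0 <= tau ^+ m by case/andP: t01 => ? _; rewrite exprn_ge0.
have v0 := level_gt0 KK0 ux.
have y1 := young_cutoff q1 nq w0 t01 z01.
have w'0 : 0 <= u / K0 * level K u `^ (- q^-1) by rewrite mulr_ge0 ?powR_ge0.
have y2 := young_cutoff q1 nq w'0 t01 c01.
have pl := profile_int_le a0 a1 KK0 chi q1 z0 ux.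
have pz := profile_ge_zeta a0 a1 KK0 z0 zc ux.
have pc := profile_ge_chi a0 a1 KK0 chi z0 ux.
have q0 : 0 < q by lra.
have w'q : (u / K0 * level K u `^ (- q^-1)) `^ q = (u / K0) `^ q / level K u.
  rewrite powRM ?powR_ge0// -powRrM mulNr mulVf ?gt_eqF//.
  by rewrite powR_inv1// ltW.
rewrite w'q in y2.
set ic := chi ^+ 2 / level K u in pc y2.
have pc' : ic <= profile a K zeta chi u.
  apply: le_trans pc; rewrite /ic -mulrA ler_peMl ?divr_ge0 ?sqr_ge0 ?(ltW v0)//; lra.
have W0 : 0 <= (u / K0) `^ q * tau ^+ n.+2 by rewrite mulr_ge0 ?powR_ge0.
set Z := (u / K0) `^ q * (tau ^+ n.+2 * profile a K zeta chi u).
have b1 : tau ^+ n.+1 * (zeta * (u / K0)) <= 1 + Z.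
  apply: le_trans y1 _; rewrite lerD2l /Z.
  by rewrite [leLHS]mulrA [leRHS]mulrA ler_wpM2l.
have b2 : tau ^+ n.+1 * (chi ^+ 2 * (u / K0 * level K u `^ (- q^-1))) <= 1 + Z.
  apply: le_trans y2 _; rewrite lerD2l /Z.
  have -> : (u / K0) `^ q / level K u * (tau ^+ n.+2 * chi ^+ 2) =
     (u / K0) `^ q * tau ^+ n.+2 * ic by rewrite /ic; ring.
  by rewrite [leRHS]mulrA ler_wpM2l.
have := ler_wpM2l (tn n.+1) pl => /le_trans; apply.
have -> : tau ^+ n.+1 * (2 * (zeta * u) +
     2 * cq * (chi ^+ 2 * (u * level K u `^ (- q^-1)))) =
    K0 * (2 * (tau ^+ n.+1 * (zeta * (u / K0))) + 2 * cq *
     (tau ^+ n.+1 * (chi ^+ 2 * (u / K0 * level K u `^ (- q^-1))))).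
  by field; rewrite gt_eqF.
rewrite [leRHS]mulrCA ler_pM2l//; have cq2 : 0 <= 2 * cq by rewrite mulr_ge0.
by have := ler_wpM2l cq2 b2; lra.
Qed.

End MasterPrelim.

(** * The energy estimate at one scale *)

Section Master.
Context {R : realType} {V : choiceType} (G : weighted_graph R V).
Variables (sigma : V -> R) (q a : R) (n : nat).

Definition mass (B : seq V) : R := \sum_(x <- B) nu G sigma x.

Definition weighted_power K (B : seq V) (xi chi : V -> R) (u : R -> V -> R) t : R :=
  \sum_(x <- B) nu G sigma x *
     (u t x `^ q * profile a K (xi x ^+ n.+2) (chi x) (u t x)).

Definition power_integral K B xi chi u ts T : R :=
  tint ts (2 * T) (fun t => cutoff T t ^+ n.+2 * weighted_power K B xi chi u t).

(** The part of the integral that pays for the derivatives of the cutoffs: the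
    time interval [[T, 2T]], and, with the weight [grad2], the vertices with an
    edge across which the metric cutoff varies.  Edges may be long, so such
    vertices need not lie in an annulus; only the weights will be summable. *)
Definition ring_integral K B xi chi u ts T (r : R) : R :=
  tint T (2 * T) (fun t => cutoff T t ^+ n.+2 * weighted_power K B xi chi u t)
  + \sum_(x <- B) r ^+ 2 * grad2 G xi x *
      tint ts (2 * T) (fun t => cutoff T t ^+ n.+2 * (u t x `^ q * xi x ^+ n.+2)).

Definition flux_const : R := 2 + n.+2%:R ^+ 2 / a.

Definition master_const : R :=
  8 + 8 * flux_const + n.+2%:R * (2 + 2 * (q / (q - 1))).

(** The last two hypotheses say that the metric cutoff, weighted by the gain
    [lam^(-a)], and the potential, weighted by [lam], both vary on the time
    scale [T]. *)
Lemma caccioppoli (K0 lam r ts T : R) (B : seq V) (xi chi : V -> R)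
    (u : R -> V -> R) :
  (forall x, 0 < nu G sigma x) -> 1 < q -> 0 < a -> a < 1 -> 1 + a <= q ->
  (0 < n)%N -> n.+2%:R <= n.+1%:R * q -> n.+2%:R * (1 + a) <= n%:R * q ->
  nonneg_supersolution G sigma q u ->
  0 < K0 -> 0 < lam -> 0 < ts -> ts <= T ->
  uniq B ->
  (forall x, 0 <= xi x <= 1) -> (forall x, 0 <= chi x <= 1) ->
  (forall x, xi x != 0 -> chi x = 1) ->
  (forall x, x \notin B -> chi x = 0) ->
  (forall x, r ^+ 2 * grad2 G xi x <= 4 * nu G sigma x) ->
  T * lam `^ (- a) <= r ^+ 2 ->
  lam * energy G chi * T <= 2 * mass B ->
  power_integral (lam * K0) B xi chi u ts T <=
  master_const * (K0 * mass B +
    K0 `^ (1 - q) / T * ring_integral (lam * K0) B xi chi u ts T r).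
Proof.
move=> nu0 q1 a0 a1 aq n0 nq nq' [u0 uC usup] K00 lam0 ts0 tsT uB xi01 chi01
  xichi chiB gradB Tlam lamE.
set K := lam * K0; have KK0 : 0 < K by rewrite mulr_gt0.
have T0 : 0 < T by lra.
have q0 : 0 < q by lra.
have C20 : 0 <= flux_const by rewrite addr_ge0// divr_ge0 ?sqr_ge0// ltW.
have zeta0 x : 0 <= xi x ^+ n.+2 by have /andP[? _] := xi01 x; rewrite exprn_ge0.
have zeta1 x : 0 <= xi x ^+ n.+2 <= 1.
  by rewrite zeta0/=; have /andP[? ?] := xi01 x; rewrite exprn_ile1.
have chi2 x : 0 <= chi x ^+ 2 <= 1.
  by rewrite sqr_ge0/=; have /andP[? ?] := chi01 x; rewrite exprn_ile1.
have zetachi x : xi x ^+ n.+2 <= chi x ^+ 2.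
  have [->|/xichi ->] := eqVneq (xi x) 0; first by rewrite expr0n sqr_ge0.
  by rewrite expr1n; have /andP[] := zeta1 x.
pose Th x t := profile a K (xi x ^+ n.+2) (chi x) (u t x).
pose Psi x t := profile_int a K (xi x ^+ n.+2) (chi x) (u t x).
have cu x : cont_pos (fun t => u t x).
  move=> t t0; apply/differentiable_continuous/derivable1_diffP.
  by have [h _] := uC x t t0; exact: h.
have cu' x : cont_pos (derive1 (fun t => u t x)).
  by move=> t t0; have [] := uC x t t0.
have Du (x : V) (t : R) : 0 < t -> is_derive t 1 (fun t => u t x) (derive1 (fun t => u t x) t).
  move=> t0; have [h _] := uC x t t0.
  by rewrite derive1E; exact: DeriveDef.
have cuq x : cont_pos (fun t => u t x `^ q).
  by apply: (cont_pos_powR q0 _ (cu x)) => t; exact: u0.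
have cTh x : cont_pos (Th x) by apply: (cont_pos_profile a0 KK0 (cu x) (fun t => @u0 t x)).
pose X := weighted_power K B xi chi u.
have cX : cont_pos X.
  by apply: cont_pos_sum => x; apply: cont_posZ; exact: (cont_posM (cuq x) (cTh x)).
pose eta t := cutoff T t ^+ n.+2.
have ceta : cont_pos eta by exact: cont_pos_cutoff.
pose Y t := \sum_(x <- B) nu G sigma x * Psi x t.
pose dY t := \sum_(x <- B) nu G sigma x * (Th x t * derive1 (fun t => u t x) t).
have cdY : cont_pos dY.
  by apply: cont_pos_sum => x; apply: cont_posZ; exact: (cont_posM (cTh x) (cu' x)).
have DY (t : R) : 0 < t -> is_derive t 1 Y (dY t).
  move=> t0; rewrite /Y /dY; elim: B {uB chiB lamE X cX Y dY cdY} => [|x s IH].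
    by under eq_fun do rewrite big_nil; rewrite big_nil; exact: is_derive_cst.
  under eq_fun do rewrite big_cons.
  rewrite big_cons; apply: is_deriveD.
  have := is_derive_profile_int a0 a1 KK0 (xi x ^+ n.+2) (chi x) (u0 t x t0) (Du x t t0).
  by move=> h; have := is_deriveZ (nu G sigma x) h.
pose Xi x t := eta t * (u t x `^ q * xi x ^+ n.+2).
have cXi x : cont_pos (Xi x).
  by apply: cont_posM => //; apply: cont_posM => //; exact: cont_pos_cst.
pose g x := grad2 G xi x.
have g0 x : 0 <= g x by apply: nbr_sum_ge0 => y _; exact: sqr_ge0.
pose c0 := 2 * K * energy G chi
   + flux_const * lam `^ (- a) * K0 * \sum_(x <- B) g x.
pose F t := c0 + flux_const * lam `^ (- a) * K0 `^ (1 - q) * \sum_(x <- B) g x * Xi x t.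
have K0q : K0 * K0 `^ (- q) = K0 `^ (1 - q).
  by rewrite powRD ?powRr1 ?(ltW K00)// (gt_eqF K00) implybT.
have wq (x : V) (t : R) : 0 < t -> (u t x / K0) `^ q = K0 `^ (- q) * u t x `^ q.
  move=> t0; rewrite powRM ?u0 ?invr_ge0 ?(ltW K00)// mulrC.
  by rewrite -(powR_inv1 (ltW K00)) -powRrM mulN1r.
have eta01 (t : R) : t <= 2 * T -> 0 <= eta t <= 1.
  by move=> tT; have /andP[? ?] := cutoff01 T0 tT; rewrite exprn_ge0//= exprn_ile1.
have cF : cont_pos F.
  apply: cont_posD; first exact: cont_pos_cst.
  by apply: cont_posZ; apply: cont_pos_sum => x; exact: cont_posZ.
have XF (t : R) : ts <= t <= 2 * T -> eta t * X t <= eta t * dY t + F t.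
  move=> /andP[t1 t2]; have t0 : 0 < t by lra.
  have /andP[e0 e1] := eta01 t t2.
  have fl := profile_flux_le G a0 a1 KK0 n0 uB xi01 xichi chiB
    (fun x => u0 t x t0).
  set N := \sum_(x <- B) profile _ _ _ _ _ * _ in fl.
  have h1 : X t + N <= dY t.
    rewrite /X /weighted_power /N /dY -big_split/=; apply: ler_sum => x _.
    have := usup t x t0; rewrite /laplacian -/(nbr_sum G x (fun y => u t y - u t x)).
    rewrite lerBrDr => h.
    have Th0 : 0 <= nu G sigma x * Th x t.
      rewrite mulr_ge0 ?(ltW (nu0 x))//.
      apply: le_trans (zeta0 x) _.
      exact: profile_ge_zeta (zeta0 x) (zetachi x) (u0 t x t0).
    have := ler_wpM2l Th0 h; rewrite -/(Th x t).
    have -> : nu G sigma x * Th x t *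
       (u t x `^ q + (nu G sigma x)^-1 * nbr_sum G x (fun y => u t y - u t x)) =
       nu G sigma x * (u t x `^ q * Th x t) +
       Th x t * nbr_sum G x (fun y => u t y - u t x).
      by field; rewrite gt_eqF.
    by move=> h4; apply: le_trans h4 _; rewrite mulrA.
  have h2 x : eta t * (K * (u t x / K) `^ (1 + a) * xi x ^+ n * g x) <=
     lam `^ (- a) * K0 * g x + lam `^ (- a) * K0 `^ (1 - q) * (g x * Xi x t).
    have e01 : 0 <= eta t <= 1 by rewrite e0.
    have yg := flux_young a0 aq n0 nq' lam0 K00 e01 (xi01 x) (u0 t x t0).
    rewrite -K0q /Xi; have := ler_wpM2r (g0 x) yg.
    by rewrite -/K wq//; lra.
  have h3 : eta t * (K * (2 * energy G chi + flux_const *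
     \sum_(x <- B) (u t x / K) `^ (1 + a) * xi x ^+ n * g x)) <= F t.
    have E0 := energy_ge0 G chi.
    have -> : eta t * (K * (2 * energy G chi + flux_const *
     \sum_(x <- B) (u t x / K) `^ (1 + a) * xi x ^+ n * g x)) =
      eta t * (2 * K * energy G chi) + flux_const *
      \sum_(x <- B) eta t * (K * (u t x / K) `^ (1 + a) * xi x ^+ n * g x).
      rewrite (_ : \sum_(x <- B) eta t * _ = eta t * K *
        \sum_(x <- B) (u t x / K) `^ (1 + a) * xi x ^+ n * g x); first ring.
      by rewrite mulr_sumr; apply: eq_bigr => x _; ring.
    have s1 : eta t * (2 * K * energy G chi) <= 2 * K * energy G chi.
      by rewrite ler_piMl// mulr_ge0// mulr_ge0// ltW.
    have s2' : \sum_(x <- B) eta t * (K * (u t x / K) `^ (1 + a) * xi x ^+ n * g x) <=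
      lam `^ (- a) * K0 * \sum_(x <- B) g x +
      lam `^ (- a) * K0 `^ (1 - q) * \sum_(x <- B) g x * Xi x t.
      by rewrite !mulr_sumr -big_split/=; apply: ler_sum => x _; exact: h2.
    have s2 := ler_wpM2l C20 s2'.
    rewrite /F /c0; lra.
  have := ler_wpM2l e0 h1; rewrite mulrDr.
  have := ler_wpM2l e0 fl; rewrite mulrN -/flux_const.
  move: h3; rewrite /g; lra.
pose cq := q / (q - 1).
have cq0 : 0 <= cq by rewrite divr_ge0; lra.
pose H t := n.+2%:R / T * ((2 + 2 * cq) * (K0 * mass B + K0 `^ (1 - q) * (eta t * X t))).
have cH : cont_pos H.
  apply: cont_posZ; apply: cont_posZ; apply: cont_posD; first exact: cont_pos_cst.
  by apply: cont_posZ; apply: cont_posM.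
have YH (t : R) : T <= t <= 2 * T -> n.+2%:R / T * (cutoff T t ^+ n.+1 * Y t) <= H t.
  move=> /andP[t1 t2]; have t0 : 0 < t by lra.
  rewrite ler_wpM2l ?divr_ge0 ?(ltW T0)//.
  rewrite /Y /X /weighted_power /mass !mulr_sumr -big_split/= mulr_sumr.
  apply: ler_sum => x _.
  have /andP[_ c1] := chi2 x.
  have yg := profile_int_young a0 a1 KK0 K00 q1 nq (cutoff01 T0 t2) (zeta1 x) c1
    (zetachi x) (u0 t x t0).
  rewrite mulrCA; apply: le_trans (ler_wpM2l (ltW (nu0 x)) yg) _.
  by rewrite le_eqVlt; apply/orP; left; apply/eqP; rewrite wq// -K0q /eta /cq; ring.
have Y0 : 0 <= Y ts.
  apply: sumr_ge0 => x _; rewrite mulr_ge0 ?(ltW (nu0 x))//.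
  exact: (profile_int_ge0 a0 a1 KK0 (zeta0 x) (zetachi x) (u0 ts x ts0)).
have main := time_cutoff_ineq ts0 tsT cdY cX cF cH DY Y0 XF YH.
rewrite -/eta in main.
rewrite /power_integral -/K -/eta; apply: le_trans main _.
have cetaX : cont_pos (fun t => eta t * X t) by exact: cont_posM.
have TT : T <= 2 * T by lra.
have tsTT : ts <= 2 * T by lra.
have iH : tint T (2 * T) H = n.+2%:R * (2 + 2 * cq) * (K0 * mass B +
    K0 `^ (1 - q) / T * tint T (2 * T) (fun t => eta t * X t)).
  rewrite /H tintZ//; last first.
    apply: cont_posZ; apply: cont_posD; first exact: cont_pos_cst.
    exact: cont_posZ.
  rewrite tintZ//; last first.
    apply: cont_posD; first exact: cont_pos_cst.
    exact: cont_posZ.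
  rewrite tintD//; [|exact: cont_pos_cst|exact: cont_posZ].
  rewrite tint_cst// tintZ//; field; by rewrite gt_eqF.
have iF : tint ts (2 * T) F = c0 * (2 * T - ts) +
   flux_const * lam `^ (- a) * K0 `^ (1 - q) *
     \sum_(x <- B) g x * tint ts (2 * T) (Xi x).
  rewrite /F tintD//; first last.
  - by apply: cont_posZ; apply: cont_pos_sum => x; exact: cont_posZ.
  - exact: cont_pos_cst.
  rewrite tint_cst// tintZ//; last by apply: cont_pos_sum => x; exact: cont_posZ.
  rewrite tint_sum//; last by move=> x; exact: cont_posZ.
  by congr (_ + _ * _); apply: eq_bigr => x _; rewrite tintZ.
rewrite iH iF /ring_integral -/K -/eta -/X.
set S1 := tint T (2 * T) _.
have -> : \sum_(x <- B) r ^+ 2 * grad2 G xi x * tint ts (2 * T)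
   (fun t => eta t * (u t x `^ q * xi x ^+ n.+2)) =
   r ^+ 2 * \sum_(x <- B) g x * tint ts (2 * T) (Xi x).
  by rewrite mulr_sumr; apply: eq_bigr => x _; rewrite mulrA.
set S2 := \sum_(x <- B) _ * _.
have S20 : 0 <= S2.
  apply: sumr_ge0 => x _; rewrite mulr_ge0//; apply: tint_ge0 => t /andP[_ tT].
  have /andP[? _] := eta01 t tT.
  by rewrite mulr_ge0// mulr_ge0 ?powR_ge0.
have S10 : 0 <= S1.
  apply: tint_ge0 => t /andP[t1 tT]; have t0 : 0 < t by lra.
  have /andP[? _] := eta01 t tT.
  rewrite mulr_ge0//; apply: sumr_ge0 => x _.
  rewrite mulr_ge0 ?(ltW (nu0 x))// mulr_ge0 ?powR_ge0//.
  apply: le_trans (zeta0 x) _.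
  exact: profile_ge_zeta (zeta0 x) (zetachi x) (u0 t x t0).
have M0 : 0 <= mass B by apply: sumr_ge0 => x _; exact: ltW.
have kq0 : 0 <= K0 `^ (1 - q) / T by rewrite divr_ge0 ?powR_ge0// ltW.
have lama : lam `^ (- a) <= r ^+ 2 / T by rewrite ler_pdivlMr// mulrC.
have E0 : 0 <= c0.
  rewrite addr_ge0//.
    by rewrite mulr_ge0 ?energy_ge0// mulr_ge0// ltW.
  rewrite mulr_ge0//; last exact: sumr_ge0.
  by rewrite mulr_ge0 ?(ltW K00)// mulr_ge0 ?powR_ge0.
have sumg : r ^+ 2 * \sum_(x <- B) g x <= 4 * mass B.
  by rewrite /mass !mulr_sumr; apply: ler_sum => x _; exact: gradB.
have sg0 : 0 <= \sum_(x <- B) g x by apply: sumr_ge0 => x _.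
have p1 : c0 * (2 * T - ts) <= (8 + 8 * flux_const) * (K0 * mass B).
  apply: (@le_trans _ _ (c0 * (2 * T))); first by rewrite ler_wpM2l//; lra.
  have -> : c0 * (2 * T) = 4 * K0 * (lam * energy G chi * T) +
    2 * flux_const * K0 * ((T * lam `^ (- a)) * \sum_(x <- B) g x).
    by rewrite /c0 /K; ring.
  have hE := ler_wpM2l (ltac:(lra) : 0 <= 4 * K0) lamE.
  have h : T * lam `^ (- a) * \sum_(x <- B) g x <= 4 * mass B.
    by apply: le_trans sumg; rewrite ler_wpM2r.
  have k : 0 <= 2 * flux_const * K0 by rewrite mulr_ge0 ?(ltW K00)// mulr_ge0.
  have hG := ler_wpM2l k h; lra.
have p2 : flux_const * lam `^ (- a) * K0 `^ (1 - q) * S2 <=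
   flux_const * (K0 `^ (1 - q) / T * (r ^+ 2 * S2)).
  have -> : flux_const * (K0 `^ (1 - q) / T * (r ^+ 2 * S2)) =
    flux_const * (r ^+ 2 / T) * K0 `^ (1 - q) * S2 by ring.
  by rewrite ler_wpM2r// ler_wpM2r ?powR_ge0// ler_wpM2l.
rewrite /master_const -/cq.
set N := n.+2%:R * (2 + 2 * cq).
have N0 : 0 <= N by rewrite mulr_ge0// addr_ge0// mulr_ge0.
have q1' : 0 <= flux_const * (K0 `^ (1 - q) / T * S1).
  by rewrite mulr_ge0// mulr_ge0.
have q2' : 0 <= N * (K0 `^ (1 - q) / T * (r ^+ 2 * S2)).
  by rewrite mulr_ge0// mulr_ge0// mulr_ge0 ?sqr_ge0.
have q3' : 0 <= K0 `^ (1 - q) / T * S1 by rewrite mulr_ge0.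
have q4' : 0 <= K0 `^ (1 - q) / T * (r ^+ 2 * S2).
  by rewrite mulr_ge0// mulr_ge0 ?sqr_ge0.
have q5' : 0 <= flux_const * (K0 `^ (1 - q) / T * (r ^+ 2 * S2)) by rewrite mulr_ge0.
lra.
Qed.

End Master.

(** * From the energy estimate to a telescoping sum *)

Section Absorption.
Context {R : realType}.
Implicit Types (q A B C D E M T c y : R).

(** With [K0 = A / (2 C M)] the first term on the right is half of [A], hence
    absorbed in [B]. *)
Lemma absorption q C A B D M T : 1 < q -> 0 < C -> 0 < A -> A <= B -> 0 < M ->
  0 < T -> D <= 5 * B ->
  B <= C * (A / (2 * C * M) * M + (A / (2 * C * M)) `^ (1 - q) / T * D) ->
  let c := 2 * C * (2 * C) `^ (q - 1) in
  T * M `^ (1 - q) <= 5 * c * A `^ (1 - q) /\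
  T * M `^ (1 - q) * A <= c * A `^ (1 - q) * D.
Proof.
move=> q1 C0 A0 AB M0 T0 DB main c.
have B0 : 0 < B by exact: lt_le_trans AB.
have c0 : 0 < c by rewrite !mulr_gt0// powR_gt0// mulr_gt0.
have eK : (A / (2 * C * M)) `^ (1 - q) =
    A `^ (1 - q) * ((2 * C) `^ (q - 1) / M `^ (1 - q)).
  have M2 : 0 < 2 * C * M by rewrite !mulr_gt0.
  rewrite powRM ?invr_ge0 ?(ltW A0) ?(ltW M2)//; congr (_ * _).
  rewrite -(powR_inv1 (ltW M2)) -powRrM mulN1r opprB.
  rewrite powRM ?(ltW M0) ?mulr_ge0 ?(ltW C0)//; congr (_ * _).
  by rewrite -powRN opprB.
have Mq : 0 < M `^ (1 - q) by rewrite powR_gt0.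
have key : T * M `^ (1 - q) * B <= c * A `^ (1 - q) * D.
  move: main; rewrite mulrDr.
  have -> : C * (A / (2 * C * M) * M) = A / 2 by field; rewrite !gt_eqF.
  have -> : C * ((A / (2 * C * M)) `^ (1 - q) / T * D) =
      (c * A `^ (1 - q) * D / (T * M `^ (1 - q))) / 2.
    by rewrite eK /c; field; rewrite !gt_eqF.
  move=> h; rewrite mulrC -ler_pdivlMr ?mulr_gt0//.
  set Z := c * _ * D / _ in h *; lra.
have Aq : 0 <= A `^ (1 - q) by rewrite powR_ge0.
split.
  rewrite -(ler_pM2r B0); apply: le_trans key _.
  have -> : 5 * c * A `^ (1 - q) * B = c * A `^ (1 - q) * (5 * B) by ring.
  by rewrite ler_wpM2l// mulr_ge0// ltW.
by apply: le_trans key; rewrite ler_wpM2l// mulr_ge0// ltW.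
Qed.

(** For y at most 1 this is the tangent inequality; beyond, the right-hand side
    increases in y. *)
Lemma sub_powRN_ge q y : 1 < q -> 0 <= y ->
  (q - 1) * 2 `^ (- q) * Num.min 1 y <= 1 - (1 + y) `^ (1 - q).
Proof.
move=> q1 y0.
have key z : 0 <= z -> z <= 1 -> (q - 1) * 2 `^ (- q) * z <= 1 - (1 + z) `^ (1 - q).
  move=> z0 z1.
  have := @powRN_tangent R (q - 1) (1 + z) 1.
  have -> : - (q - 1) - 1 = - q by ring.
  have -> : - (q - 1) = 1 - q by ring.
  have -> : 1 + z - 1 = z by ring.
  rewrite powR1 => h; apply: le_trans (h ltac:(lra) ltr01 ltac:(lra)).
  rewrite ler_wpM2r// ler_wpM2l ?subr_ge0 ?(ltW q1)// !powRN.
  rewrite lef_pV2 ?posrE ?powR_gt0//; last lra.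
  by apply: ge0_ler_powR; rewrite ?nnegrE; lra.
have [y1|y1] := leP 1 y; last by apply: key => //; exact: ltW.
apply: le_trans (key 1 ler01 (lexx 1)) _.
rewrite lerB// -!(opprB q 1) !powRN lef_pV2 ?posrE ?powR_gt0//; last lra.
by apply: ge0_ler_powR; rewrite ?nnegrE; lra.
Qed.

(** Both bounds on [s] are needed: the second gives the telescoping increment
    when [D] is at most [E], and the first when [D] is larger, in which case the
    power of [E + D] is a fixed fraction below that of [E]. *)
Lemma telescoping_step q c0 c A D E s : 1 < q -> 0 < A -> 0 < E -> 0 <= D ->
  0 < c0 -> 0 <= c -> E <= c0 * A ->
  s <= 5 * c * A `^ (1 - q) -> s * A <= c * A `^ (1 - q) * D ->
  s <= (5 + c0) * (c * c0 `^ (q - 1)) / ((q - 1) * 2 `^ (- q)) *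
    (E `^ (1 - q) - (E + D) `^ (1 - q)).
Proof.
move=> q1 A0 E0 D0 c00 cp EA s1 s2.
have k0 : 0 < (q - 1) * 2 `^ (- q) by rewrite mulr_gt0 ?powR_gt0 ?subr_gt0.
set k := (q - 1) * 2 `^ (- q) in k0 *.
pose y := D / E; have y0 : 0 <= y by rewrite divr_ge0// ltW.
have Eq : 0 < E `^ (1 - q) by rewrite powR_gt0.
have -> : (E + D) `^ (1 - q) = E `^ (1 - q) * (1 + y) `^ (1 - q).
  rewrite -powRM ?(ltW E0)//; last by rewrite addr_ge0.
  by congr (_ `^ _); rewrite /y; field; rewrite gt_eqF.
have -> : E `^ (1 - q) - E `^ (1 - q) * (1 + y) `^ (1 - q) =
  E `^ (1 - q) * (1 - (1 + y) `^ (1 - q)) by ring.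
have h := sub_powRN_ge q1 y0; rewrite -/k in h.
have AE : A `^ (1 - q) <= c0 `^ (q - 1) * E `^ (1 - q).
  have -> : c0 `^ (q - 1) * E `^ (1 - q) = (E / c0) `^ (1 - q).
    rewrite powRM ?invr_ge0 ?(ltW E0) ?(ltW c00)// mulrC; congr (_ * _).
    by rewrite -(powR_inv1 (ltW c00)) -powRrM mulN1r opprB.
  rewrite -!(opprB q 1) !powRN lef_pV2 ?posrE ?powR_gt0 ?divr_gt0//.
  apply: ge0_ler_powR;
    rewrite ?nnegrE ?subr_ge0 ?(ltW q1) ?divr_ge0 ?(ltW E0) ?(ltW A0) ?(ltW c00)//.
  by rewrite ler_pdivrMr// mulrC.
have cqm : 0 <= c0 `^ (q - 1) by rewrite powR_ge0.
set e := E `^ (1 - q) in Eq AE *.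
have s1' : s <= 5 * c * (c0 `^ (q - 1) * e).
  by apply: le_trans s1 _; rewrite ler_wpM2l// mulr_ge0.
have s2' : s <= c * (c0 `^ (q - 1) * e) * (c0 * y).
  have ciA : A^-1 <= c0 / E.
    by rewrite lter_pdivlMr// mulrC ler_pdivrMr.
  have : s <= c * A `^ (1 - q) * D / A by rewrite ler_pdivlMr.
  move/le_trans; apply.
  have -> : c0 * y = D * (c0 / E) by rewrite /y; ring.
  rewrite -mulrA; apply: ler_pM => //.
  - by rewrite mulr_ge0// powR_ge0.
  - by rewrite mulr_ge0// invr_ge0 ltW.
  - by rewrite ler_wpM2l.
  - by rewrite ler_wpM2l.
have W0 : 0 <= c * (c0 `^ (q - 1) * e).
  by rewrite mulr_ge0// mulr_ge0// ltW.
apply: (@le_trans _ _ (c * (c0 `^ (q - 1) * e) * ((5 + c0) * Num.min 1 y))).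
  have [y1|y1] := leP 1 y; last by nra.
  by rewrite mulr1; nra.
have -> : c * (c0 `^ (q - 1) * e) * ((5 + c0) * Num.min 1 y) =
  (5 + c0) * (c * c0 `^ (q - 1)) / k * (e * (k * Num.min 1 y)).
  by field; rewrite gt_eqF.
rewrite ler_wpM2l//; last by rewrite ler_pM2l.
rewrite divr_ge0 ?(ltW k0)// mulr_ge0//; first lra.
exact: mulr_ge0.
Qed.

End Absorption.

(** * The path metric and radial cutoffs *)

Section Ramp.
Context {R : realType}.
Implicit Types (r s c d e : R).

Lemma minrB_bounds c d e : d <= e -> 0 <= Num.min c e - Num.min c d <= e - d.
Proof.
move=> de; apply/andP; case: (leP c e) => ?; case: (leP c d) => ?; split; lra.
Qed.

Lemma maxrB_bounds c d e : d <= e -> 0 <= Num.max c e - Num.max c d <= e - d.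
Proof.
move=> de; apply/andP; case: (leP c e) => ?; case: (leP c d) => ?; split; lra.
Qed.

Definition ramp (r s d : R) : R := Num.min 1 (Num.max 0 ((s - d) / (s - r))).

Lemma ramp01 r s d : 0 <= ramp r s d <= 1.
Proof. by rewrite /ramp le_min ler01 le_max lexx/= ge_min lexx. Qed.

Lemma ramp_eq1 r s d : r < s -> d <= r -> ramp r s d = 1.
Proof.
move=> rs dr; apply: min_l; rewrite le_max; apply/orP; right.
by rewrite ler_pdivlMr ?subr_gt0//; lra.
Qed.

Lemma ramp_eq0 r s d : r < s -> s <= d -> ramp r s d = 0.
Proof.
move=> rs sd; rewrite /ramp (max_l (y := _ / _)); first exact/min_r/ler01.
by rewrite pmulr_lle0 ?invr_gt0 ?subr_gt0// subr_le0.
Qed.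

Lemma ramp_lipschitz r s d e : r < s -> d <= e ->
  0 <= ramp r s d - ramp r s e <= (e - d) / (s - r).
Proof.
move=> rs de; have k0 : 0 < (s - r)^-1 by rewrite invr_gt0 subr_gt0.
have h : (s - e) / (s - r) = (s - d) / (s - r) - (e - d) / (s - r) by ring.
have h' : 0 <= (e - d) / (s - r) by rewrite mulr_ge0 ?subr_ge0// ltW.
rewrite /ramp; set a := (s - d) / (s - r) in h *.
have ba : (s - e) / (s - r) <= a by lra.
have /andP[m1 m2] := maxrB_bounds 0 ba.
have /andP[m3 m4] : 0 <= Num.min 1 (Num.max 0 a) -
    Num.min 1 (Num.max 0 ((s - e) / (s - r))) <=
    Num.max 0 a - Num.max 0 ((s - e) / (s - r)).
  by apply: minrB_bounds; rewrite -subr_ge0.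
by rewrite m3/= (le_trans m4)// (le_trans m2)//; lra.
Qed.


Lemma ramp_sqr_lipschitz r s d e : r < s ->
  (ramp r s d - ramp r s e) ^+ 2 <= (d - e) ^+ 2 / (s - r) ^+ 2.
Proof.
move=> rs; wlog de : d e / d <= e.
  move=> H; have [/H//|/ltW/H] := leP d e.
  by rewrite -(opprB (ramp r s d)) -(opprB d) !sqrrN.
have /andP[h0 h1] := ramp_lipschitz rs de.
rewrite -(opprB e) sqrrN -exprVn -exprMn.
by apply: lerXn2r; rewrite ?nnegrE// (le_trans h0).
Qed.

Lemma sum_sqr_le (I : Type) (t : seq I) (F : I -> R) : (forall i, 0 <= F i) ->
  \sum_(i <- t) F i ^+ 2 <= (\sum_(i <- t) F i) ^+ 2.
Proof.
move=> F0; elim: t => [|i t IH]; first by rewrite !big_nil expr0n.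
rewrite !big_cons; have S0 : 0 <= \sum_(j <- t) F j by apply: sumr_ge0.
have := F0 i; nra.
Qed.

(** The ramps vary on the disjoint intervals [[r i / 2, r i]], with slope
    [2 / r i], so their decreases from d to e, weighted by [r i], add up to at
    most 2 (e - d).  The truncation at [r n / 2], where the next ramp begins,
    carries the induction. *)
Lemma sum_ramp_le (r : nat -> R) n d e : (forall i, 0 < r i) ->
  (forall i, 4 * r i <= r i.+1) -> d <= e ->
  \sum_(i < n) r i * (ramp (r i / 2) (r i) d - ramp (r i / 2) (r i) e) <=
  2 * (Num.min e (r n / 2) - Num.min d (r n / 2)).
Proof.
move=> r0 r4 de; elim: n => [|n IH].
  rewrite big_ord0 mulr_ge0// subr_ge0.
  by rewrite le_min !ge_min de lexx !orbT.
rewrite big_ord_recr/=.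
have h (a : R) : r n * ramp (r n / 2) (r n) a =
   Num.min (r n) (Num.max 0 (2 * (r n - a))).
  rewrite /ramp; have -> : r n - r n / 2 = r n / 2 by field.
  have -> : (r n - a) / (r n / 2) = (2 * (r n - a)) / r n.
    by field; rewrite gt_eqF.
  rewrite minr_pMr ?(ltW (r0 n))// maxr_pMr ?(ltW (r0 n))// mulr1 mulr0.
  by rewrite (mulrC (r n)) divfK// gt_eqF.
rewrite mulrBr !h; apply: le_trans (lerD IH (lexx _)) _.
have := r4 n; have := r0 n; move: (r n) (r n.+1) => s s' s0 ss'.
have key (a : R) : 2 * Num.min a (s / 2) - Num.min s (Num.max 0 (2 * (s - a))) =
    2 * Num.min a s - s.
  have [as2|as2] := leP a (s / 2).
    by rewrite [Num.min a s]min_l ?max_r ?min_l; lra.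
  have [as1|as1] := leP a s.
    by rewrite max_r ?min_r; lra.
  by rewrite max_l ?min_r; lra.
have mono : Num.min e s - Num.min d s <= Num.min e (s' / 2) - Num.min d (s' / 2).
  have /andP[_] := @minrB_bounds s (Num.min d (s' / 2)) (Num.min e (s' / 2)) ltac:(
    by have /andP[? _] := @minrB_bounds (s' / 2) _ _ de; rewrite !(minC _ (s' / 2)) -subr_ge0).
  have ss2 : s <= s' / 2 by lra.
  by rewrite !(minC s) -!minA !(min_r ss2).
have := key d; have := key e; lra.
Qed.

(** A sum of squares is at most the square of the sum; this is how the scales
    share the length of one edge, however long it is. *)
Lemma sum_ramp_sqr_le (r : nat -> R) n d e : (forall i, 0 < r i) ->
  (forall i, 4 * r i <= r i.+1) ->
  \sum_(i < n) r i ^+ 2 * (ramp (r i / 2) (r i) d - ramp (r i / 2) (r i) e) ^+ 2 <=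
  4 * (d - e) ^+ 2.
Proof.
move=> r0 r4; wlog de : d e / d <= e.
  move=> H; have [/H//|/ltW/H] := leP d e.
  rewrite -(opprB d) sqrrN => h; apply: le_trans h.
  by apply: ler_sum => i _; rewrite -(opprB (ramp _ _ e)) sqrrN.
have := sum_ramp_le n r0 r4 de.
set F := fun i : 'I_n => r i * (ramp (r i / 2) (r i) d - ramp (r i / 2) (r i) e).
move=> h; apply: (@le_trans _ _ ((\sum_(i < n) F i) ^+ 2)).
  under eq_bigr do rewrite -exprMn.
  apply: sum_sqr_le => i; rewrite mulr_ge0 ?(ltW (r0 i))//.
  have rr : r i / 2 < r i by have := r0 i; lra.
  by have /andP[] := ramp_lipschitz rr de.
have F0 : 0 <= \sum_(i < n) F i.
  apply: sumr_ge0 => i _; rewrite mulr_ge0 ?(ltW (r0 i))//.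
  have rr : r i / 2 < r i by have := r0 i; lra.
  by have /andP[] := ramp_lipschitz rr de.
have {}h : \sum_(i < n) F i <= 2 * (e - d).
  apply: le_trans h _; rewrite ler_pM2l//.
  by case: (leP e (r n / 2)) => ?; case: (leP d (r n / 2)) => ?; lra.
have -> : 4 * (d - e) ^+ 2 = (2 * (e - d)) ^+ 2 by ring.
by apply: lerXn2r; rewrite ?nnegrE// (le_trans F0).
Qed.

End Ramp.

Section Metric.
Context {R : realType} {V : choiceType} (G : weighted_graph R V).
Variables (sigma : V -> R) (rho : V -> V -> R) (o : V).
Hypotheses (sigma_gt0 : forall x, 0 < sigma x) (rho_edge : edge_length G rho)
  (rho_adapted : adapted G sigma rho) (rho_proper : proper_metric G rho).

Local Notation dist := (path_metric G rho o).
Local Notation nu := (nu G sigma).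

Lemma path_length_ge0 x p : path (adj G) x p -> 0 <= path_length rho x p.
Proof.
rewrite /path_length; elim: p x => [|y p IH] x /=; first by rewrite big_nil.
by case/andP=> xy yp; rewrite big_cons addr_ge0 ?IH//; have [/ltW] := rho_edge xy.
Qed.

Lemma path_metric_le x p : path (adj G) o p -> last o p = x ->
  dist x <= path_length rho o p.
Proof.
move=> op ox; apply: ge_inf; last by exists p.
by exists 0 => _ [p' [? _] <-]; exact: path_length_ge0.
Qed.

Lemma path_metric_ge0 x : 0 <= dist x.
Proof.
apply: lb_le_inf; last by move=> _ [p [? _] <-]; exact: path_length_ge0.
by have [p op ox] := connected_graph G o x; exists (path_length rho o p), p.
Qed.

Lemma path_metric_self : dist o = 0.
Proof.
apply/eqP; rewrite eq_le path_metric_ge0 andbT.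
by have := @path_metric_le o [::] isT erefl; rewrite /path_length/= big_nil.
Qed.

Lemma path_metric_step x y : adj G x y -> dist y <= dist x + rho x y.
Proof.
move=> xy; rewrite -lerBlDr; apply: lb_le_inf.
  by have [p op ox] := connected_graph G o x; exists (path_length rho o p), p.
move=> _ [p [op ox] <-]; rewrite lerBlDr.
have -> : path_length rho o p + rho x y = path_length rho o (rcons p y).
  rewrite /path_length -ox; elim: (p) o => [|z s IH] w /=.
    by rewrite big_nil big_cons big_nil add0r addr0.
  by rewrite !big_cons -addrA IH.
by apply: path_metric_le; rewrite ?last_rcons// rcons_path op ox.
Qed.

Lemma path_metric_lipschitz x y : adj G x y -> `|dist x - dist y| <= rho x y.
Proof.
move=> xy; have h1 := path_metric_step xy.
have yx : adj G y x by rewrite adj_sym.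
have h2 := path_metric_step yx; have [_ e] := rho_edge xy.
by rewrite ler_norml; apply/andP; split; lra.
Qed.

Lemma exists_nbr x : exists y, adj G x y.
Proof.
have [y yx] : exists y, y <> x.
  apply: contrapT => /forallNP h; apply: (vertices_infinite G).
  apply: (@sub_finite_set _ _ [set x]) => // y _; exact: contrapT (h y).
have [[|z p]/=] := connected_graph G x y; first by move=> _ xy; case: yx.
by case/andP=> xz _ _; exists z.
Qed.

Lemma nu_gt0 x : 0 < nu x.
Proof.
have [y xy] := exists_nbr x.
rewrite mulr_gt0// /mu_vertex (fsbig_finite _ _ (locally_finite G x)).
have yW : y \in fset_set (nbrs G x).
  by rewrite in_fset_set ?mem_setE//; exact: locally_finite.
rewrite (big_rem y)//= ltr_pwDl ?weight_gt0//.
by apply: sumr_ge0 => z _; exact: weight_ge0.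
Qed.

Definition ball_seq (r : R) : seq V := fset_set (rball G rho o r).

Lemma mem_ball_seq r x : (x \in ball_seq r) = (dist x <= r).
Proof. by rewrite in_fset_set ?mem_setE//; exact: rho_proper. Qed.

Lemma uniq_ball_seq r : uniq (ball_seq r).
Proof. exact: fset_uniq. Qed.

Lemma volumeE r : volume G sigma rho o r = \sum_(x <- ball_seq r) nu x.
Proof. by rewrite /volume /nu_set (fsbig_finite _ _ (rho_proper _ _)). Qed.

Lemma volume_gt0 r : 0 <= r -> 0 < volume G sigma rho o r.
Proof.
move=> r0; rewrite volumeE (big_rem o)/=; last by rewrite mem_ball_seq path_metric_self.
by rewrite ltr_pwDl ?nu_gt0//; apply: sumr_ge0 => x _; exact/ltW/nu_gt0.
Qed.

Lemma le_volume r s : r <= s -> volume G sigma rho o r <= volume G sigma rho o s.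
Proof.
move=> rs; rewrite !volumeE.
apply: ler_sum_subset; rewrite ?uniq_ball_seq//.
  by move=> x; rewrite !mem_ball_seq => xr; exact: le_trans xr rs.
by move=> x _; exact/ltW/nu_gt0.
Qed.

Definition radial (r s : R) (x : V) : R := ramp r s (dist x).

Lemma sqr_path_metric_le x y : adj G x y -> (dist x - dist y) ^+ 2 <= rho x y ^+ 2.
Proof.
move=> xy; rewrite -real_normK ?num_real//.
by apply: lerXn2r; rewrite ?nnegrE ?path_metric_lipschitz//; have [/ltW] := rho_edge xy.
Qed.

Lemma grad2_radial_le r s x : r < s ->
  (s - r) ^+ 2 * grad2 G (radial r s) x <= nu x.
Proof.
move=> rs; rewrite /grad2 -nbr_sumZ; apply: le_trans (rho_adapted x).
rewrite -[leRHS]/(nbr_sum G x (fun y => rho x y ^+ 2)); apply: ler_nbr_sum => y xy.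
apply: le_trans (sqr_path_metric_le xy).
rewrite mulrC -ler_pdivlMr; last by rewrite exprn_gt0// subr_gt0.
exact: ramp_sqr_lipschitz.
Qed.

(** By [sum_ramp_sqr_le] on each edge, the gradients of all scales together obey
    the bound that [grad2_radial_le] gives for a single scale. *)
Lemma sum_grad2_radial_le (r : nat -> R) n x : (forall i, 0 < r i) ->
  (forall i, 4 * r i <= r i.+1) ->
  \sum_(i < n) r i ^+ 2 * grad2 G (radial (r i / 2) (r i)) x <= 4 * nu x.
Proof.
move=> r0 r4; have h := rho_adapted x.
apply: (@le_trans _ _ (4 * nbr_sum G x (fun y => rho x y ^+ 2))); last first.
  by rewrite ler_pM2l.
rewrite -nbr_sumZ; under eq_bigr do rewrite -nbr_sumZ.
rewrite -nbr_sum_sum; apply: ler_nbr_sum => y xy.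
apply: le_trans (sum_ramp_sqr_le n _ _ r0 r4) _.
by rewrite ler_pM2l// sqr_path_metric_le.
Qed.

End Metric.

(** * Energy and capacity *)

Section Energy.
Context {R : realType} {V : choiceType} (G : weighted_graph R V).
Implicit Types f : V -> R.

Lemma energy_le_sum_grad2 (B : seq V) f : uniq B ->
  (forall x, x \notin B -> f x = 0) -> energy G f <= \sum_(x <- B) grad2 G f x.
Proof.
move=> uB fB; have [W uW hW] := exists_hull G B; have [BW nW] := hW.
rewrite (energyE uW hW fB).
pose t x y := weight G x y * (f x - f y) ^+ 2.
have t0 x y : 0 <= t x y by rewrite mulr_ge0 ?weight_ge0 ?sqr_ge0.
have tC x y : t x y = t y x by rewrite /t weight_sym -(opprB (f y)) sqrrN.
pose s x y := if x \in B then t x y else 0.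
have -> : \sum_(x <- B) grad2 G f x = \sum_(x <- W) \sum_(y <- W) s x y.
  have -> : \sum_(x <- B) grad2 G f x = \sum_(x <- B) \sum_(y <- W) s x y.
    apply: eq_big_seq => x xB; rewrite /grad2 (@nbr_sumE _ _ G W)//.
      by apply: eq_bigr => y _; rewrite /s xB.
    by move=> y yW; rewrite weight_eq0 ?mul0r//; apply: contra yW; exact: nW.
  by apply: eq_big_seq_support => // x /negbTE xB; rewrite big1// => y _; rewrite /s xB.
set S := (X in _ <= X).
have SE : S = \sum_(x <- W) \sum_(y <- W) s y x by rewrite /S exchange_big.
suff : \sum_(x <- W) \sum_(y <- W) t x y <= S + S.
  by rewrite ler_pdivrMl//; lra.
rewrite {2}SE /S -big_split/=; apply: ler_sum => x _.
rewrite -big_split/=; apply: ler_sum => y _; rewrite /s (tC y x).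
have := t0 x y; case: ifP => [_|/negbT xB]; case: ifP => [_|/negbT yB]; try lra.
by rewrite /t (fB _ xB) (fB _ yB) subrr expr0n mulr0 addr0.
Qed.

Lemma energy_ge_edge f x y : finite_set [set x | f x != 0] ->
  2^-1 * (weight G x y * (f x - f y) ^+ 2) <= energy G f.
Proof.
move=> ff; pose B : seq V := fset_set [set x | f x != 0].
have fB z : z \notin B -> f z = 0.
  by rewrite in_fset_set// notin_setE/= => /negP; rewrite negbK => /eqP.
have t0 z w : 0 <= weight G z w * (f z - f w) ^+ 2.
  by rewrite mulr_ge0 ?weight_ge0 ?sqr_ge0.
have [W uW hW] := exists_hull G B; have [BW nW] := hW.
have [xy|/weight_eq0 ->] := boolP (adj G x y); last first.
  by rewrite mul0r mulr0 energy_ge0.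
have [fxy|fxy] := eqVneq (f x) (f y).
  by rewrite fxy subrr expr0n !mulr0 energy_ge0.
have [xW yW] : x \in W /\ y \in W.
  have [xB|xB] := boolP (x \in B); first by split; [exact: BW|exact: nW xy].
  have [yB|yB] := boolP (y \in B).
    by split; [apply: (nW y) => //; rewrite adj_sym|exact: BW].
  by move: fxy; rewrite (fB _ xB) (fB _ yB) eqxx.
rewrite (energyE uW hW fB) ler_pM2l ?invr_gt0//.
rewrite (big_rem x)//= (big_rem y)//= -addrA lerDl addr_ge0//.
  by apply: sumr_ge0 => z _.
by apply: sumr_ge0 => z _; apply: sumr_ge0 => w _.
Qed.

(** Along a fixed path each edge difference is controlled by the energy. *)
Lemma path_oscillation_le x p : path (adj G) x p ->
  exists2 c : R, 0 <= c & forall f, finite_set [set x | f x != 0] ->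
    `|f x - f (last x p)| <= c * Num.sqrt (energy G f).
Proof.
elim: p x => [|y p IH] x /=.
  by exists 0 => // f _; rewrite subrr normr0 mul0r.
case/andP=> xy /IH[c c0 hc].
exists (Num.sqrt (2 / weight G x y) + c); first by rewrite addr_ge0// sqrtr_ge0.
move=> f ff; rewrite mulrDl (le_trans (ler_distD (f y) _ _))// lerD ?hc//.
have w0 := weight_gt0 xy.
rewrite -sqrtrM; last by rewrite divr_ge0// ltW.
rewrite -sqrtr_sqr ler_wsqrtr// mulrAC ler_pdivlMr//.
have := energy_ge_edge x y ff; rewrite ler_pdivrMl// mulrC; lra.
Qed.

Definition clamp f x : R := Num.min 1 (Num.max 0 (f x)).

Lemma clamp_id f x : 0 <= f x <= 1 -> clamp f x = f x.
Proof. by case/andP=> f0 f1; rewrite /clamp max_r// min_r. Qed.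

Lemma clamp01 f x : 0 <= clamp f x <= 1.
Proof. by rewrite /clamp le_min ler01 le_max lexx/= ge_min lexx. Qed.

Lemma energy_clamp_le f : finite_set [set x | f x != 0] ->
  energy G (clamp f) <= energy G f.
Proof.
move=> ff; pose B : seq V := fset_set [set x | f x != 0].
have fB z : z \notin B -> f z = 0.
  by rewrite in_fset_set// notin_setE/= => /negP; rewrite negbK => /eqP.
have [W uW hW] := exists_hull G B.
have cB z : z \notin B -> clamp f z = 0.
  by move=> /fB h; rewrite clamp_id h// lexx ler01.
rewrite (energyE uW hW fB) (energyE uW hW cB) ler_pM2l ?invr_gt0//.
apply: ler_sum => x _; apply: ler_sum => y _; rewrite ler_wpM2l ?weight_ge0//.
wlog fxy : x y / f x <= f y.
  move=> H; have [/H//|/ltW/H] := leP (f x) (f y).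
  by rewrite -(opprB (f x)) -(opprB (clamp f x)) !sqrrN.
have /andP[m1 m2] := maxrB_bounds 0 fxy.
have /andP[m3 m4] : 0 <= clamp f y - clamp f x <= Num.max 0 (f y) - Num.max 0 (f x).
  by apply: minrB_bounds; rewrite -subr_ge0.
rewrite -(opprB (f y)) -(opprB (clamp f y)) !sqrrN.
apply: lerXn2r; rewrite ?nnegrE//; first by rewrite subr_ge0.
exact: le_trans m4 m2.
Qed.

End Energy.

Section Capacity.
Context {R : realType} {V : choiceType} (G : weighted_graph R V).
Variables (sigma : V -> R) (rho : V -> V -> R) (o : V).
Hypotheses (sigma_gt0 : forall x, 0 < sigma x) (rho_edge : edge_length G rho)
  (rho_adapted : adapted G sigma rho) (rho_proper : proper_metric G rho).

Local Notation dist := (path_metric G rho o).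
Local Notation volume := (volume G sigma rho o).
Local Notation capacity := (capacity G rho o).

Lemma radial_cap_test r : 0 < r ->
  cap_test G rho o r (2 * r) (radial G rho o r (2 * r)).
Proof.
move=> r0; have r2 : r < 2 * r by lra.
split; last first.
- by move=> x /negP; rewrite -ltNge => h; apply: ramp_eq0 => //; exact: ltW.
- by move=> x h; apply: ramp_eq1.
apply: sub_finite_set (rho_proper o (2 * r)) => x /= h; rewrite /rball/= leNgt.
by apply: contra h => h; apply/eqP/ramp_eq0 => //; exact: ltW.
Qed.

Lemma test_energies_nonempty r : 0 < r ->
  [set energy G f | f in cap_test G rho o r (2 * r)] !=set0.
Proof.
move=> r0; exists (energy G (radial G rho o r (2 * r))).
by exists (radial G rho o r (2 * r)) => //; exact: radial_cap_test.
Qed.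

Lemma energy_radial_le r : 0 < r ->
  r ^+ 2 * energy G (radial G rho o r (2 * r)) <= volume (2 * r).
Proof.
move=> r0; have r2 : r < 2 * r by lra.
rewrite (volumeE sigma o rho_proper).
have h := @energy_le_sum_grad2 _ _ G (ball_seq G rho o (2 * r))
  (radial G rho o r (2 * r)) (uniq_ball_seq _ _ _ _).
apply: (@le_trans _ _ (r ^+ 2 * \sum_(x <- ball_seq G rho o (2 * r))
     grad2 G (radial G rho o r (2 * r)) x)).
  rewrite ler_pM2l ?exprn_gt0//; apply: h => x.
  by rewrite mem_ball_seq// -ltNge => h; apply: ramp_eq0 => //; exact: ltW.
rewrite mulr_sumr; apply: ler_sum => x _.
have := grad2_radial_le o rho_edge rho_adapted x r2.
by have -> : 2 * r - r = r by ring.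
Qed.

(** The truncation at 1 costs nothing, as the radial ramp already has energy at
    most [volume (2 * r) / r ^+ 2]. *)
Definition spread (r : R) : R := Num.max 1 (volume (2 * r) / (r ^+ 2 * capacity r)).

(** If the spread is 1 the radial ramp will do; otherwise a test function of
    energy at most twice the capacity, clamped to the unit interval. *)
Lemma exists_potential r : 0 < r -> exists chi : V -> R,
  [/\ forall x, 0 <= chi x <= 1, forall x, dist x <= r -> chi x = 1,
      forall x, 2 * r < dist x -> chi x = 0 &
      r ^+ 2 * spread r * energy G chi <= 2 * volume (2 * r)].
Proof.
move=> r0; have r2 : r < 2 * r by lra.
have M0 : 0 < volume (2 * r).
  by apply: (volume_gt0 o sigma_gt0 rho_edge rho_proper); lra.
rewrite /spread; set z := _ / _; case: (leP 1 z) => z1; last first.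
  exists (radial G rho o r (2 * r)); split.
  - by move=> x; exact: ramp01.
  - by move=> x; exact: ramp_eq1.
  - by move=> x h; apply: ramp_eq0 => //; exact: ltW.
  - by rewrite mulr1; have := energy_radial_le r0; lra.
have C0 : 0 < capacity r.
  rewrite lt0r; apply/andP; split.
    by apply: contraTneq z1 => C0; rewrite -ltNge /z C0 mulr0 invr0 mulr0.
  apply: lb_le_inf; first exact: test_energies_nonempty.
  by move=> _ [f _ <-]; exact: energy_ge0.
have hi : has_inf [set energy G f | f in cap_test G rho o r (2 * r)].
  split; first exact: test_energies_nonempty.
  by exists 0 => _ [f _ <-]; exact: energy_ge0.
have [_ [f [ff f1 f0] <-] Ef] := inf_adherent C0 hi.
exists (clamp f); split.
- by move=> x; exact: clamp01.
- by move=> x h; rewrite clamp_id f1// ler01 lexx.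
- move=> x h; rewrite clamp_id f0 ?lexx ?ler01//.
  + by rewrite /rball/=; apply/negP; rewrite -ltNge.
  + by rewrite /rball/=; apply/negP; rewrite -ltNge.
have -> : r ^+ 2 * z = volume (2 * r) / capacity r.
  by rewrite /z; field; rewrite !gt_eqF.
rewrite mulrAC ler_pdivrMr// (_ : 2 * _ * _ = volume (2 * r) * (2 * capacity r)); last ring.
rewrite ler_pM2l//.
have := energy_clamp_le G ff; move: Ef; rewrite -/(capacity2 _ _ _ _ _) -/(capacity r); lra.
Qed.

(** A test function at scale r <= s equals 1 at [o] and vanishes at a vertex
    outside the ball of radius [2 s], so it oscillates by 1 along a fixed
    path. *)
Lemma capacity_bounded_below (s : R) : exists2 c, 0 < c &
  forall r, 0 < r -> r <= s -> c <= capacity r.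
Proof.
have [z zs] : exists z, 2 * s < dist z.
  apply: contrapT => /forallNP h; apply: (vertices_infinite G).
  apply: sub_finite_set (rho_proper o (2 * s)) => x _ /=.
  by rewrite /rball/= leNgt; apply/negP; exact: h.
have [p op oz] := connected_graph G o z.
have [c c0 hc] := path_oscillation_le op.
exists ((c + 1) ^- 2); first by rewrite invr_gt0 exprn_gt0//; lra.
move=> r r0 rs; apply: lb_le_inf; first exact: test_energies_nonempty.
move=> _ [f [ff f1 f0] <-].
have := hc f ff; rewrite oz f1; last first.
  by rewrite /rball/= path_metric_self// ltW.
rewrite f0; last by rewrite /rball/=; apply/negP; rewrite -ltNge; lra.
rewrite subr0 normr1 => h.
have sE := sqrtr_ge0 (energy G f).
have E0 := energy_ge0 G f.
rewrite -[leLHS]mul1r ler_pdivrMr ?exprn_gt0//; last lra.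
rewrite -(sqr_sqrtr E0) -exprMn expr_ge1 ?mulr_ge0 ?addr_ge0//; lra.
Qed.

End Capacity.

(** * Summing the energy estimates over nested scales *)

Section Nested.
Context {R : realType} {V : choiceType} (G : weighted_graph R V).
Variables (sigma : V -> R) (rho : V -> V -> R) (o : V) (q a : R) (n : nat).
Variables (u : R -> V -> R) (ts : R).
Hypotheses (sigma_gt0 : forall x, 0 < sigma x) (rho_edge : edge_length G rho)
  (rho_adapted : adapted G sigma rho) (rho_proper : proper_metric G rho).
Hypotheses (q_gt1 : 1 < q) (a_gt0 : 0 < a) (a_lt1 : a < 1).
Hypotheses (u_super : nonneg_supersolution G sigma q u) (ts_gt0 : 0 < ts).

Local Notation nu := (nu G sigma).
Local Notation dist := (path_metric G rho o).
Local Notation Ball := (ball_seq G rho o).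
Local Notation ringcut r := (radial G rho o (r / 2) r).

Let u_ge0 t x : 0 < t -> 0 <= u t x.
Proof. by case: u_super => h _ _; exact: h. Qed.

Let cont_u x : cont_pos (fun t => u t x).
Proof.
case: u_super => _ h _ t t0; apply/differentiable_continuous/derivable1_diffP.
by have [d _] := h x t t0; exact: d.
Qed.

Let q_gt0 : 0 < q. Proof. by move: q_gt1; lra. Qed.

Let cont_uq x : cont_pos (fun t => u t x `^ q).
Proof.
apply: (@cont_pos_powR _ q (fun t => u t x)); [exact: q_gt0| |exact: cont_u].
by move=> t; exact: u_ge0.
Qed.

Let uq_ge0 x t : 0 < t -> 0 <= u t x `^ q.
Proof. by move=> _; exact: powR_ge0. Qed.

Definition ball_integral (r T : R) : R :=
  \sum_(x <- Ball (r / 2)) nu x * tint ts T (fun t => u t x `^ q).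

Section OneScale.
Variables (K r T : R) (chi : V -> R).
Hypotheses (K_gt0 : 0 < K) (r_gt0 : 0 < r) (tsT : ts <= T).
Hypotheses (chi01 : forall x, 0 <= chi x <= 1)
  (chi1 : forall x, dist x <= r -> chi x = 1).

Local Notation xi := (ringcut r).
Local Notation B := (Ball (2 * r)).
Local Notation Th x t := (profile a K (xi x ^+ n.+2) (chi x) (u t x)).

Let T_gt0 : 0 < T. Proof. by move: tsT ts_gt0; lra. Qed.

Let rr : r / 2 < r. Proof. by move: r_gt0; lra. Qed.

Lemma ringcut01 x : 0 <= xi x <= 1. Proof. exact: ramp01. Qed.

Lemma ringcut_chi x : xi x != 0 -> chi x = 1.
Proof.
move=> h; apply: chi1; rewrite leNgt; apply: contra h => h.
by apply/eqP; apply: ramp_eq0 => //; exact: ltW.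
Qed.

Let zeta01 x : 0 <= xi x ^+ n.+2 <= 1.
Proof. by have /andP[? ?] := ringcut01 x; rewrite exprn_ge0//= exprn_ile1. Qed.

Let chi_sqr x : 0 <= chi x ^+ 2 <= 1.
Proof. by have /andP[? ?] := chi01 x; rewrite exprn_ge0//= exprn_ile1. Qed.

Let zeta_le_chi x : xi x ^+ n.+2 <= chi x ^+ 2.
Proof.
have [->|/ringcut_chi ->] := eqVneq (xi x) 0; first by rewrite expr0n sqr_ge0.
by rewrite expr1n; have /andP[] := zeta01 x.
Qed.

Let Th_ge x t : 0 < t -> xi x ^+ n.+2 <= Th x t.
Proof.
move=> t0; have /andP[z0 _] := zeta01 x.
exact: (profile_ge_zeta a_gt0 a_lt1 K_gt0 z0 (zeta_le_chi x) (u_ge0 x t0)).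
Qed.

Let Th_ge0 x t : 0 < t -> 0 <= Th x t.
Proof. by move=> t0; apply: le_trans (Th_ge x t0); have /andP[] := zeta01 x. Qed.

Let Th_le2 x t : 0 < t -> Th x t <= 2.
Proof.
move=> t0; have /andP[z0 _] := zeta01 x; have /andP[_ c1] := chi_sqr x.
exact: (profile_le2 a_gt0 a_lt1 K_gt0 z0 (zeta_le_chi x) c1 (u_ge0 x t0)).
Qed.

Let nu_ge0 x : 0 <= nu x. Proof. exact/ltW/nu_gt0. Qed.

Let cont_Th x : cont_pos (fun t => Th x t).
Proof.
exact: (@cont_pos_profile _ a K (xi x ^+ n.+2) (chi x) _ a_gt0 K_gt0 (@cont_u x)
  (fun t => @u_ge0 t x)).
Qed.

Let cont_wp : cont_pos (weighted_power G sigma q a n K B xi chi u).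
Proof.
apply: cont_pos_sum => x; apply: cont_posZ.
exact: (cont_posM (@cont_uq x) (@cont_Th x)).
Qed.

Let wp_ge0 t : 0 < t -> 0 <= weighted_power G sigma q a n K B xi chi u t.
Proof.
move=> t0; apply: sumr_ge0 => x _.
by rewrite mulr_ge0// mulr_ge0 ?powR_ge0// Th_ge0.
Qed.

Let cut01 t : t <= 2 * T -> 0 <= cutoff T t ^+ n.+2 <= 1.
Proof.
by move=> h; have /andP[? ?] := cutoff01 T_gt0 h; rewrite exprn_ge0//= exprn_ile1.
Qed.

Let cont_cwp : cont_pos (fun t => cutoff T t ^+ n.+2 * weighted_power G sigma q a n K B xi chi u t).
Proof. exact: cont_posM (@cont_pos_cutoff _ _ _) cont_wp. Qed.

Let cont_cu x : cont_pos (fun t => cutoff T t ^+ n.+2 * (u t x `^ q * xi x ^+ n.+2)).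
Proof.
apply: cont_posM; first exact: cont_pos_cutoff.
by apply: cont_posM => //; exact: cont_pos_cst.
Qed.

Let r2grad x : 0 <= r ^+ 2 * grad2 G xi x.
Proof. by rewrite mulr_ge0 ?sqr_ge0//; apply: nbr_sum_ge0 => y _; exact: sqr_ge0. Qed.

Lemma grad2_ringcut_le x : r ^+ 2 * grad2 G xi x <= 4 * nu x.
Proof.
have := grad2_radial_le o rho_edge rho_adapted x rr.
have -> : (r - r / 2) ^+ 2 = r ^+ 2 / 4 by field.
lra.
Qed.

Lemma ball_integral_le_power : ball_integral r T <=
  power_integral G sigma q a n K B xi chi u ts T.
Proof.
have TT : T <= 2 * T by move: T_gt0; lra.
rewrite /power_integral -(tint_cat ts_gt0 tsT TT cont_cwp).
rewrite -[leLHS]addr0; apply: lerD; last first.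
  apply: tint_ge0 => t /andP[t1 t2]; have /andP[c0 _] := cut01 t2.
  by rewrite mulr_ge0// wp_ge0// (lt_le_trans T_gt0).
rewrite /ball_integral.
have -> : \sum_(x <- Ball (r / 2)) nu x * tint ts T (fun t => u t x `^ q) =
   tint ts T (fun t => \sum_(x <- Ball (r / 2)) nu x * u t x `^ q).
  rewrite tint_sum//; last by move=> x; exact: cont_posZ.
  by apply: eq_bigr => x _; rewrite tintZ.
apply: le_tint => //; first by apply: cont_pos_sum => x; exact: cont_posZ.
move=> t /andP[t1 t2]; have t0 : 0 < t by exact: lt_le_trans t1.
rewrite (cutoff_eq1 T_gt0 t2) expr1n mul1r.
apply: ler_sum_subset; rewrite ?uniq_ball_seq//.
- move=> x; rewrite !mem_ball_seq// => /le_trans; apply; by move: r_gt0; lra.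
- move=> x; rewrite mem_ball_seq// => xr; rewrite ler_pM2l ?nu_gt0//.
  rewrite ler_peMr ?powR_ge0//; apply: le_trans (Th_ge x t0).
  by rewrite /radial ramp_eq1// expr1n.
- by move=> x _; rewrite mulr_ge0// mulr_ge0 ?powR_ge0// Th_ge0.
Qed.

Let D := ring_integral G sigma q a n K B xi chi u ts T r.

Lemma ring_integral_ge0 : 0 <= D.
Proof.
rewrite addr_ge0//.
  apply: tint_ge0 => t /andP[t1 t2]; have /andP[c0 _] := cut01 t2.
  by rewrite mulr_ge0// wp_ge0// (lt_le_trans T_gt0).
apply: sumr_ge0 => x _; rewrite mulr_ge0//; apply: tint_ge0 => t /andP[_ t2].
have /andP[c0 _] := cut01 t2; have /andP[z0 _] := zeta01 x.
by rewrite mulr_ge0// mulr_ge0 ?powR_ge0.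
Qed.

Lemma ring_integral_le_power : D <= 5 * power_integral G sigma q a n K B xi chi u ts T.
Proof.
have -> : 5 * power_integral G sigma q a n K B xi chi u ts T =
  power_integral G sigma q a n K B xi chi u ts T +
  4 * power_integral G sigma q a n K B xi chi u ts T by ring.
apply: lerD.
  rewrite /power_integral -(tint_cat ts_gt0 tsT _ cont_cwp); last by move: T_gt0; lra.
  rewrite lerDr; apply: tint_ge0 => t /andP[t1 t2].
  have /andP[c0 _] : 0 <= cutoff T t ^+ n.+2 <= 1.
    by apply: cut01; move: T_gt0; lra.
  by rewrite mulr_ge0// wp_ge0// (lt_le_trans ts_gt0).
apply: (@le_trans _ _ (\sum_(x <- B) 4 * nu x * tint ts (2 * T)
    (fun t => cutoff T t ^+ n.+2 * (u t x `^ q * xi x ^+ n.+2)))).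
  apply: ler_sum => x _; rewrite ler_wpM2r ?grad2_ringcut_le//.
  apply: tint_ge0 => t /andP[_ t2]; have /andP[c0 _] := cut01 t2.
  by have /andP[z0 _] := zeta01 x; rewrite mulr_ge0// mulr_ge0 ?powR_ge0.
under eq_bigr do rewrite -mulrA.
rewrite -mulr_sumr ler_pM2l// /power_integral.
under eq_bigr do rewrite -(tintZ _ _ ts_gt0 (@cont_cu _)).
rewrite -tint_sum//; last by move=> x; exact: cont_posZ.
apply: le_tint => //; first by apply: cont_pos_sum => x; exact: cont_posZ.
move=> t /andP[t1 t2]; have t0 : 0 < t by exact: lt_le_trans t1.
have /andP[c0 _] := cut01 t2.
rewrite /weighted_power mulr_sumr; apply: ler_sum => x _.
by rewrite mulrCA ler_wpM2l// ler_pM2l ?nu_gt0// ler_wpM2l ?powR_ge0// Th_ge.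
Qed.

Lemma ring_integral_le_plain : D <= \sum_(x <- B)
  (2 * nu x * tint T (2 * T) (fun t => u t x `^ q) +
   r ^+ 2 * grad2 G xi x * tint ts (2 * T) (fun t => u t x `^ q)).
Proof.
rewrite big_split/=; apply: lerD.
  under eq_bigr do rewrite -tintZ//.
  rewrite -tint_sum//; last by move=> x; exact: cont_posZ.
  apply: le_tint => //; first by apply: cont_pos_sum => x; exact: cont_posZ.
  move=> t /andP[t1 t2]; have t0 : 0 < t by exact: lt_le_trans t1.
  have /andP[c0 c1] := cut01 t2.
  apply: (@le_trans _ _ (weighted_power G sigma q a n K B xi chi u t)).
    by rewrite ler_piMl// wp_ge0.
  apply: ler_sum => x _.
  rewrite (_ : 2 * nu x * u t x `^ q = nu x * (2 * u t x `^ q)); last ring.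
  rewrite ler_pM2l ?nu_gt0//.
  by rewrite mulrC ler_wpM2r ?powR_ge0// Th_le2.
apply: ler_sum => x _; rewrite ler_wpM2l//; apply: le_tint => //.
move=> t /andP[t1 t2]; have /andP[c0 c1] := cut01 t2; have /andP[z0 z1] := zeta01 x.
apply: (@le_trans _ _ (u t x `^ q * xi x ^+ n.+2)).
  by rewrite ler_piMl// mulr_ge0 ?powR_ge0.
by rewrite ler_piMr ?powR_ge0.
Qed.

End OneScale.

Section Scales.
Variables (r T : nat -> R).
Hypotheses (r_gt0 : forall i, 0 < r i) (r4 : forall i, 4 * r i <= r i.+1).
Hypotheses (tsT : ts <= T 0%N) (T4 : forall i, 4 * T i <= T i.+1).

Lemma scales_time i : ts <= T i.
Proof. by elim: i => // i IH; have := T4 i; move: ts_gt0; lra. Qed.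

Let T_gt0 i : 0 < T i. Proof. exact: lt_le_trans (scales_time i). Qed.

Lemma scales_nested i j : (j < i)%N -> 4 * r j <= r i /\ 4 * T j <= T i.
Proof.
elim: i => // i IH; rewrite ltnS leq_eqVlt => /predU1P[->|/IH[h1 h2]].
  by split.
have := r4 i; have := T4 i; have := r_gt0 i; have := T_gt0 i; split; lra.
Qed.

(** The time intervals [[T j, 2 T j]] are disjoint. *)
Lemma sum_tint_le i (f : R -> R) : cont_pos f -> (forall t, 0 < t -> 0 <= f t) ->
  \sum_(j < i) tint (T j) (2 * T j) f <= tint ts (T i) f.
Proof.
move=> cf f0; elim: i => [|i IH].
  by rewrite big_ord0; apply: tint_ge0 => t /andP[h _]; apply/f0/(lt_le_trans ts_gt0).
rewrite big_ord_recr/=; apply: le_trans (lerD IH (lexx _)) _.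
have h0 := T_gt0 i; have h1 := scales_time i; have h2 := T4 i.
rewrite tint_cat//; last lra.
by apply: tint_le_itv => //; lra.
Qed.

(** Bounded overlap of the sets that pay for the cutoffs: in time the intervals
    are disjoint, in space the weights [grad2] are summable over the scales. *)
Lemma sum_ring_le i :
  \sum_(j < i) \sum_(x <- Ball (2 * r j))
    (2 * nu x * tint (T j) (2 * T j) (fun t => u t x `^ q) +
     r j ^+ 2 * grad2 G (ringcut (r j)) x * tint ts (2 * T j) (fun t => u t x `^ q))
  <= 6 * ball_integral (r i) (T i).
Proof.
have nu0 x : 0 < nu x by exact: nu_gt0.
have g0 j x : 0 <= r j ^+ 2 * grad2 G (ringcut (r j)) x.
  by rewrite mulr_ge0 ?sqr_ge0//; apply: nbr_sum_ge0 => y _; exact: sqr_ge0.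
have I0 x b c : 0 < b -> 0 <= tint b c (fun t => u t x `^ q).
  by move=> b0; apply: tint_ge0 => t _; exact: powR_ge0.
apply: (@le_trans _ _ (\sum_(j < i) \sum_(x <- Ball (r i / 2))
    (2 * nu x * tint (T j) (2 * T j) (fun t => u t x `^ q) +
     r j ^+ 2 * grad2 G (ringcut (r j)) x * tint ts (T i) (fun t => u t x `^ q)))).
  apply: ler_sum => j _; have [rj Tj] := scales_nested (ltn_ord j).
  apply: ler_sum_subset; rewrite ?uniq_ball_seq//.
  - move=> x; rewrite !mem_ball_seq// => /le_trans; apply; lra.
  - move=> x _; rewrite lerD2l ler_wpM2l//; apply: tint_le_itv => //.
    + by have := scales_time j; have := T_gt0 j; lra.
    + by have := T_gt0 j; lra.
    + by move=> t _; exact: powR_ge0.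
  - move=> x _; apply: addr_ge0; apply: mulr_ge0; rewrite ?I0//.
    by rewrite mulr_ge0// ltW.
rewrite exchange_big/= /ball_integral mulr_sumr; apply: ler_sum => x _.
rewrite big_split/= -mulr_sumr -mulr_suml.
have s1 := sum_tint_le i (@cont_uq x) (@uq_ge0 x).
have s2 := sum_grad2_radial_le o rho_edge rho_adapted i x r_gt0 r4.
have n0 : 0 <= 2 * nu x by rewrite mulr_ge0// ltW.
have := ler_wpM2l n0 s1.
have := ler_wpM2r (I0 x ts (T i) ts_gt0) s2; lra.
Qed.

(** The quantity [A] of [absorption] is the integral over the small ball, and
    [E] in [telescoping_step] is a fixed positive number plus the ring
    integrals of all the previous scales. *)
Lemma sum_scales_bounded (lam : nat -> R) (chi : nat -> V -> R) (x0 : V) (t0 : R) :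
  1 + a <= q -> (0 < n)%N -> n.+2%:R <= n.+1%:R * q ->
  n.+2%:R * (1 + a) <= n%:R * q ->
  (forall i x, 0 <= chi i x <= 1) ->
  (forall i x, dist x <= r i -> chi i x = 1) ->
  (forall i x, 2 * r i < dist x -> chi i x = 0) ->
  (forall i, 0 < lam i) -> (forall i, T i * lam i `^ (- a) <= r i ^+ 2) ->
  (forall i, lam i * energy G (chi i) * T i <= 2 * volume G sigma rho o (2 * r i)) ->
  dist x0 <= r 0%N / 2 -> ts < t0 -> t0 <= T 0%N -> 0 < u t0 x0 ->
  exists C, forall N,
    \sum_(i < N) T i * volume G sigma rho o (2 * r i) `^ (1 - q) <= C.
Proof.
move=> aq n0 nq nq' chi01 chi1 chi0 lam0 Tlam lamE x0r tst0 t0T ux0.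
pose M i := volume G sigma rho o (2 * r i).
have M0 i : 0 < M i by apply: volume_gt0 => //; rewrite mulr_ge0// ltW.
pose C := master_const q a n.
have C0 : 0 < C.
  have c1 : 0 <= flux_const a n by rewrite addr_ge0// divr_ge0 ?sqr_ge0// ltW.
  have c2 : 0 <= q / (q - 1) by rewrite divr_ge0; move: q_gt1; lra.
  have c3 : 0 <= n.+2%:R * (2 + 2 * (q / (q - 1))) by rewrite mulr_ge0//; lra.
  by rewrite /C /master_const; lra.
pose A i := ball_integral (r i) (T i).
pose e0 := nu x0 * tint ts t0 (fun t => u t x0 `^ q).
have e00 : 0 < e0.
  rewrite mulr_gt0 ?nu_gt0//; apply: (@tint_gt0 _ ts t0 t0) => //.
  - by move=> t; exact: uq_ge0.
  - by rewrite powR_gt0.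
have r0i i : r 0%N <= r i.
  by case: i => // i; have [h _] := scales_nested (ltn0Sn i); have := r_gt0 0%N; lra.
have T0i i : T 0%N <= T i.
  by case: i => // i; have [_ h] := scales_nested (ltn0Sn i); have := T_gt0 0%N; lra.
have e0A i : e0 <= A i.
  rewrite /A /ball_integral (big_rem x0)/=; last first.
    by rewrite mem_ball_seq//; apply: le_trans x0r _; rewrite ler_pM2r// invr_gt0.
  rewrite -[leLHS]addr0; apply: lerD.
    rewrite ler_pM2l ?nu_gt0//; apply: tint_le_itv => //; first exact: ltW.
      exact: le_trans (T0i i).
    by move=> t; exact: uq_ge0.
  apply: sumr_ge0 => x _; apply: mulr_ge0; first exact/ltW/nu_gt0.
  by apply: tint_ge0 => t _; exact: powR_ge0.
have A0 i : 0 < A i by exact: lt_le_trans (e0A i).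
pose K0 i := A i / (2 * C * M i).
have K00 i : 0 < K0 i by rewrite divr_gt0// !mulr_gt0.
pose K i := lam i * K0 i.
have KK i : 0 < K i by rewrite mulr_gt0.
pose D i := ring_integral G sigma q a n (K i) (Ball (2 * r i)) (ringcut (r i))
  (chi i) u ts (T i) (r i).
pose P i := power_integral G sigma q a n (K i) (Ball (2 * r i)) (ringcut (r i))
  (chi i) u ts (T i).
have Ts := scales_time.
have D0 i : 0 <= D i by have h1 := chi01 i; have h2 := chi1 i; apply: ring_integral_ge0.
have DP i : D i <= 5 * P i by have h1 := chi01 i; have h2 := chi1 i; apply: ring_integral_le_power.
have AP i : A i <= P i by have h1 := chi01 i; have h2 := chi1 i; apply: ball_integral_le_power.
have main i : P i <= C * (K0 i * M i + K0 i `^ (1 - q) / T i * D i).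
  have mB : mass G sigma (Ball (2 * r i)) = M i by rewrite /M (volumeE sigma o rho_proper).
  have h1 := chi01 i; have h2 := chi1 i.
  rewrite -mB /P /D /C /K; apply: caccioppoli => //.
  - by move=> x; exact: nu_gt0.
  - exact: uniq_ball_seq.
  - by move=> x; exact: ringcut01.
  - by move=> x; apply: ringcut_chi.
  - by move=> x; rewrite mem_ball_seq// -ltNge; exact: chi0.
  - by move=> x; exact: grad2_ringcut_le.
  - by rewrite mB.
pose E i := e0 + \sum_(j < i) D j.
have E0 i : 0 < E i by rewrite ltr_pwDl// sumr_ge0.
have EA i : E i <= 7 * A i.
  have h : \sum_(j < i) D j <= 6 * A i.
    apply: le_trans (sum_ring_le i); apply: ler_sum => j _.
    by have h1 := chi01 j; have h2 := chi1 j; apply: ring_integral_le_plain.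
  by have := e0A i; rewrite /E; lra.
pose c := 2 * C * (2 * C) `^ (q - 1).
have c0 : 0 <= c by rewrite !mulr_ge0 ?powR_ge0// ltW.
pose C' := (5 + 7) * (c * 7 `^ (q - 1)) / ((q - 1) * 2 `^ (- q)).
have C'0 : 0 <= C'.
  rewrite divr_ge0//; first by rewrite mulr_ge0// mulr_ge0 ?powR_ge0.
  by rewrite mulr_ge0 ?powR_ge0//; move: q_gt1; lra.
have step i : T i * M i `^ (1 - q) <= C' * (E i `^ (1 - q) - E i.+1 `^ (1 - q)).
  have [s1 s2] := absorption q_gt1 C0 (A0 i) (AP i) (M0 i) (T_gt0 i) (DP i) (main i).
  have := telescoping_step q_gt1 (A0 i) (E0 i) (D0 i) (ltac:(lra) : (0 : R) < 7) c0 (EA i) s1 s2.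
  by have -> : E i.+1 = E i + D i by rewrite /E big_ord_recr/= addrA.
exists (C' * e0 `^ (1 - q)) => N.
apply: (@le_trans _ _ (C' * (e0 `^ (1 - q) - E N `^ (1 - q)))); last first.
  by rewrite ler_wpM2l// gerBl powR_ge0.
elim: N => [|N IH].
  by rewrite big_ord0 /E big_ord0 addr0 subrr mulr0.
rewrite big_ord_recr/=; apply: le_trans (lerD IH (step N)) _.
by rewrite -mulrDr ler_wpM2l//; lra.
Qed.

End Scales.

End Nested.

(** * Recovering the logarithm from the records of the time scale *)

Section Records.
Context {R : realType}.
Variables (r T P L : nat -> R) (c : R).
Hypotheses (r_ge1 : forall i, 1 <= r i) (r4 : forall i, 4 * r i <= r i.+1)
  (rT : forall i, r i ^+ 2 <= T i) (P_ge0 : forall i, 0 <= P i)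
  (P_dec : forall i, P i.+1 <= P i) (c_ge0 : 0 <= c)
  (LT : forall i, L i <= c * r i * Num.sqrt (T i)).

Let r_gt0 i : 0 < r i. Proof. by have := r_ge1 i; lra. Qed.

Let T_gt0 i : 0 < T i.
Proof. by apply: lt_le_trans (rT i); rewrite exprn_gt0. Qed.

Lemma sum_lacunary_le m : \sum_(0 <= i < m.+1) r i <= 2 * r m.
Proof.
elim: m => [|m IH]; first by rewrite big_nat1; have := r_gt0 0%N; lra.
by rewrite big_nat_recr//=; have := r4 m; have := r_gt0 m; lra.
Qed.

Lemma lacunary_ge_nat i : i%:R <= r i.
Proof.
by elim: i => [|i IH]; rewrite ?(ltW (r_gt0 _))// -natr1; have := r4 i; have := r_ge1 i; lra.
Qed.

Lemma record_exists k : exists j, (k < j)%N && (4 * T k < T j).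
Proof.
have [j jT] : exists j : nat, 4 * T k < j%:R.
  exists (Num.truncn (4 * T k)).+1; exact: truncnS_gt.
exists (maxn k.+1 j); rewrite leq_max ltnSn/=; apply: lt_le_trans (rT _).
apply: (lt_le_trans jT).
have h : j%:R <= r (maxn k.+1 j).
  by apply: le_trans (lacunary_ge_nat _); rewrite ler_nat leq_max leqnn orbT.
by apply: le_trans h _; rewrite expr2 ler_peMl// ltW.
Qed.

Definition next_record k := ex_minn (record_exists k).

Definition record n := iter n next_record 0%N.

Lemma record_lt n : (record n < record n.+1)%N.
Proof. by rewrite /record iterS /next_record; case: ex_minnP => j /andP[]. Qed.

Lemma record_time n : 4 * T (record n) <= T (record n.+1).
Proof. by rewrite /record iterS /next_record; case: ex_minnP => j /andP[_ /ltW]. Qed.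

Lemma before_next_record k i : (k <= i)%N -> (i < next_record k)%N -> T i <= 4 * T k.
Proof.
rewrite leq_eqVlt => /predU1P[<- _|ki]; first by have := T_gt0 k; lra.
rewrite /next_record; case: ex_minnP => j _ jmin ij.
rewrite leNgt; apply/negP => h; have := jmin i; rewrite ki h => /(_ isT).
by rewrite leqNgt ij.
Qed.

Lemma leq_record n : (n <= record n)%N.
Proof. by elim: n => // n IH; exact: leq_ltn_trans IH (record_lt n). Qed.

(** Before the next record the times are at most four times the current one,
    hence the radii are at most [2 sqrt (T k)], and they are summed as a
    geometric progression. *)
Lemma sum_before_record_le k :
  \sum_(k <= i < next_record k) P i * L i <= 8 * c * (T k * P k).
Proof.
have kn : (k < next_record k)%N.
  by rewrite /next_record; case: ex_minnP => j /andP[].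
have Pd i : (k <= i)%N -> P i <= P k.
  move=> ki; rewrite -(subnK ki); elim: (i - k)%N => [|d IH]; first by rewrite add0n.
  by rewrite addSn; exact: le_trans (P_dec _) IH.
have sT i : (k <= i)%N -> (i < next_record k)%N -> Num.sqrt (T i) <= 2 * Num.sqrt (T k).
  move=> ki ik; have -> : 2 * Num.sqrt (T k) = Num.sqrt (4 * T k).
    rewrite sqrtrM//; congr (_ * _).
    by have -> : (4 : R) = 2 ^+ 2 by [ring]; rewrite sqrtr_sqr ger0_norm.
  by rewrite ler_wsqrtr// before_next_record.
have s0 := sqrtr_ge0 (T k).
apply: (@le_trans _ _ (\sum_(k <= i < next_record k) P k * c * (2 * Num.sqrt (T k)) * r i)).
  rewrite big_nat [leRHS]big_nat; apply: ler_sum => i /andP[ki ik].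
  have h1 : L i <= c * r i * (2 * Num.sqrt (T k)).
    by apply: le_trans (LT i) _; rewrite ler_wpM2l ?sT// mulr_ge0// ltW.
  have h2 : 0 <= c * r i * (2 * Num.sqrt (T k)).
    by apply: mulr_ge0; apply: mulr_ge0 => //; exact: ltW.
  have h3 := ler_wpM2l (P_ge0 i) h1; have h4 := ler_wpM2r h2 (Pd i ki).
  by apply: le_trans h3 _; apply: le_trans h4 _; lra.
rewrite -mulr_sumr.
have h : \sum_(k <= i < next_record k) r i <= 4 * Num.sqrt (T k).
  apply: (@le_trans _ _ (\sum_(0 <= i < next_record k) r i)).
    rewrite [leRHS](@big_cat_nat _ _ _ k)//=; last exact: ltnW.
    by rewrite lerDr; apply: sumr_ge0 => i _; exact: ltW.
  have [m mE] : exists m, next_record k = m.+1.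
    by case: (next_record k) kn => // m _; exists m.
  rewrite mE; apply: le_trans (sum_lacunary_le m) _.
  have km : (k <= m)%N by rewrite -ltnS -mE.
  have h : r m <= Num.sqrt (T m).
    by rewrite -[leLHS]ger0_norm ?(ltW (r_gt0 m))// -sqrtr_sqr ler_wsqrtr.
  have := sT m km; rewrite mE => /(_ (ltnSn m)); lra.
have k0 : 0 <= P k * c * (2 * Num.sqrt (T k)) by rewrite mulr_ge0// mulr_ge0.
apply: le_trans (ler_wpM2l k0 h) _.
rewrite -{3}(sqr_sqrtr (ltW (T_gt0 k))); lra.
Qed.

Lemma sum_records_le N :
  \sum_(0 <= i < record N) P i * L i <=
  8 * c * \sum_(i < N) T (record i) * P (record i).
Proof.
elim: N => [|N IH]; first by rewrite big_geq// big_ord0 mulr0.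
rewrite big_ord_recr/= mulrDr (@big_cat_nat _ _ _ (record N))//=; last first.
  exact/ltnW/record_lt.
apply: lerD => //.
have := sum_before_record_le (record N); exact.
Qed.

End Records.

Section WeightedSum.
Context {R : realType} {V : choiceType} (G : weighted_graph R V).
Variables (sigma : V -> R) (rho : V -> V -> R) (o : V) (q : R) (u : R -> V -> R).
Hypotheses (sigma_gt0 : forall x, 0 < sigma x) (rho_edge : edge_length G rho)
  (rho_adapted : adapted G sigma rho) (rho_proper : proper_metric G rho).
Hypotheses (q_gt1 : 1 < q) (u_super : nonneg_supersolution G sigma q u).
Local Notation volume := (volume G sigma rho o).
Local Notation capacity := (capacity G rho o).
Local Notation dist := (path_metric G rho o).

(** The records of [T = r^2 x^(a/(1+a))] form a sequence to which
    [sum_scales_bounded] applies, with [lam = x^(1/(1+a))]. *)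
Lemma weighted_sum_bounded_from (r : nat -> R) x0 t0 :
  0 < t0 -> 0 < u t0 x0 -> 1 <= r 0%N -> dist x0 <= r 0%N / 2 -> t0 <= r 0%N ^+ 2 ->
  (forall i, 4 * r i <= r i.+1) ->
  exists C, forall N, \sum_(0 <= i < N)
    volume (2 * r i) `^ (1 - q) *
     (r i ^+ 2 * ln (1 + volume (2 * r i) / (r i ^+ 2 * capacity (r i)))) <= C.
Proof.
move=> t00 ux r01 x0r t0r r4.
(* any a in (0, 1) with 1 + a < q is suitable *)
pose a := Num.min ((q - 1) / 2) (2^-1).
have a0 : 0 < a by rewrite lt_min; apply/andP; split; move: q_gt1; lra.
have a1 : a < 1 by rewrite gt_min; apply/orP; right; lra.
have aq : a <= (q - 1) / 2 by rewrite ge_min lexx.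
have q1 := q_gt1.
(* large enough for the powers lost in young_cutoff and young_gradient *)
pose n := (Num.truncn (4 / (q - 1 - a))).+1.
have n0 : (0 < n)%N by [].
have nq' : n.+2%:R * (1 + a) <= n%:R * q.
  have h : 4 / (q - 1 - a) < n%:R by exact: truncnS_gt.
  rewrite ltr_pdivrMr in h; last lra.
  by rewrite -[n.+2]addn2 natrD; lra.
have nq : n.+2%:R <= n.+1%:R * q.
  have h : 0 <= n.+2%:R * a by rewrite mulr_ge0// ltW.
  have : n.+1%:R * q = n%:R * q + q by rewrite -natr1; ring.
  lra.
have r1 i : 1 <= r i by elim: i => // i IH; have := r4 i; lra.
have r0 i : 0 < r i by have := r1 i; lra.
pose x i := spread G sigma rho o (r i).
have x1 i : 1 <= x i by rewrite le_max lexx.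
have x0' i : 0 < x i by have := x1 i; lra.
pose p := 1 + a; have p0 : 0 < p by rewrite /p; lra.
pose T i := r i ^+ 2 * x i `^ (a / p).
have rT i : r i ^+ 2 <= T i.
  rewrite ler_peMr ?sqr_ge0// -{1}(powRr0 (x i)) ler_powR//.
  by rewrite divr_ge0 ?ltW.
pose M i := volume (2 * r i).
have M0 i : 0 < M i by apply: volume_gt0 => //; rewrite mulr_ge0// ltW.
pose P i := M i `^ (1 - q).
have P0 i : 0 <= P i by exact: powR_ge0.
have Pd i : P i.+1 <= P i.
  rewrite /P -(opprB q 1) !powRN lef_pV2 ?posrE ?powR_gt0//.
  apply: ge0_ler_powR; rewrite ?nnegrE ?subr_ge0 ?(ltW q1) ?(ltW (M0 _))//.
  by apply: le_volume => //; have := r4 i; have := r0 i; lra.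
pose L i := r i ^+ 2 * ln (1 + M i / (r i ^+ 2 * capacity (r i))).
have cap0 i : 0 <= capacity (r i).
  have [c c0 hc] := capacity_bounded_below o rho_edge rho_proper (r i).
  by apply: le_trans (hc _ (r0 i) (lexx _)); exact: ltW.
have z0 i : 0 <= M i / (r i ^+ 2 * capacity (r i)).
  by rewrite divr_ge0 ?(ltW (M0 i))// mulr_ge0 ?sqr_ge0.
(* half the exponent of x in T, so that x^e is the square root of T / r^2 *)
pose e := a / (2 * p).
have e0 : 0 < e by rewrite divr_gt0// mulr_gt0.
pose c := 1 + e^-1.
have c0 : 0 <= c by rewrite addr_ge0// invr_ge0 ltW.
have LT i : L i <= c * r i * Num.sqrt (T i).
  have -> : Num.sqrt (T i) = r i * x i `^ e.
    have -> : T i = (r i * x i `^ e) ^+ 2.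
      rewrite exprMn; congr (_ * _); rewrite -powR_mulrn ?powR_ge0// -powRrM.
      by congr (_ `^ _); rewrite /e; field; rewrite gt_eqF.
    by rewrite sqrtr_sqr ger0_norm// mulr_ge0 ?powR_ge0// ltW.
  have -> : c * r i * (r i * x i `^ e) = r i ^+ 2 * (c * x i `^ e) by ring.
  rewrite ler_wpM2l ?sqr_ge0//; apply: le_trans (ln1D_le_powR e0 (x1 i)).
  rewrite ler_ln ?posrE; [|by have := z0 i; lra|by have := x0' i; lra].
  by rewrite lerD2l /x /spread le_max lexx orbT.
pose k := record r1 r4 rT.
have pot i : exists chi : V -> R,
  [/\ forall x, 0 <= chi x <= 1, forall x, dist x <= r (k i) -> chi x = 1,
      forall x, 2 * r (k i) < dist x -> chi x = 0 &
      r (k i) ^+ 2 * x (k i) * energy G chi <= 2 * M (k i)].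
  exact: (exists_potential o sigma_gt0 rho_edge rho_adapted rho_proper (r0 (k i))).
have [chi chiP] := choice pot.
have rk i : 4 * r (k i) <= r (k i.+1).
  have := record_lt r1 r4 rT i; rewrite -/k.
  move: (k i) (k i.+1) => j l; elim: l => // l IH.
  rewrite ltnS leq_eqVlt => /predU1P[->//|/IH h].
  by have := r4 l; have := r0 l; lra.
have k00 : k 0%N = 0%N by [].
have [C hC] : exists C, forall N, \sum_(i < N) T (k i) * M (k i) `^ (1 - q) <= C.
  apply: (@sum_scales_bounded R V G sigma rho o q a n u (t0 / 2) sigma_gt0
    rho_edge rho_adapted rho_proper q_gt1 a0 a1 u_super _
    (fun i => r (k i)) (fun i => T (k i)) _ rk _ (record_time r1 r4 rT)
    (fun i => x (k i) `^ p^-1) chi x0 t0) => //.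
  - lra.
  - by rewrite k00; have := rT 0%N; lra.
  - lra.
  - by move=> i; case: (chiP i).
  - by move=> i; case: (chiP i).
  - by move=> i; case: (chiP i).
  - by move=> i; exact: powR_gt0.
  - move=> i; rewrite /T -powRrM -mulrA -powRD; last by rewrite (gt_eqF (x0' (k i))) implybT.
    by rewrite (_ : a / p + p^-1 * - a = 0) ?powRr0 ?mulr1//; ring.
  - move=> i; have [_ _ _ h] := chiP i; apply: le_trans h.
    have xE : x (k i) `^ p^-1 * x (k i) `^ (a / p) = x (k i).
      rewrite -powRD ?(gt_eqF (x0' (k i))) ?implybT//.
      have -> : p^-1 + a / p = 1 by rewrite /p; field; rewrite gt_eqF.
      by rewrite powRr1// ltW.
    have -> : r (k i) ^+ 2 * x (k i) * energy G (chi i) =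
      r (k i) ^+ 2 * (x (k i) `^ p^-1 * x (k i) `^ (a / p)) * energy G (chi i).
      by rewrite xE.
    by rewrite le_eqVlt; apply/orP; left; apply/eqP; rewrite /T; ring.
  - lra.
  - by have := rT 0%N; rewrite -[k 0%N]/0%N; lra.
exists (8 * c * C) => N.
have PL0 i : 0 <= P i * L i.
  rewrite mulr_ge0// mulr_ge0 ?sqr_ge0// ln_ge0//.
  by rewrite lerDl z0.
apply: (@le_trans _ _ (\sum_(0 <= i < k N) P i * L i)).
  rewrite [leRHS](@big_cat_nat _ _ _ N)//=; last exact: leq_record.
  by rewrite lerDl; apply: sumr_ge0 => i _; exact: PL0.
have h := @sum_records_le R r T P L c r1 r4 rT P0 Pd c0 LT N.
apply: le_trans h _.
by rewrite ler_wpM2l ?mulr_ge0//; exact: hC.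
Qed.

End WeightedSum.

(** * From the integral to sums over blocks of radii *)

Section StepIntegral.
Context {R : realType}.
Local Open Scope ereal_scope.

(** The integral of a nonnegative function is a supremum over the simple
    functions below it, so it is monotone on all nonnegative functions; this lets
    a function of the capacity at scale r, which is defined by an infimum for
    each r separately, be compared with a step function. *)
Lemma ge0_le_integral_lower d (S : measurableType d)
    (m : {measure set S -> \bar R}) (D : set S) (f g : S -> \bar R) :
  (forall x, D x -> 0 <= f x) -> (forall x, D x -> f x <= g x) ->
  \int[m]_(x in D) f x <= \int[m]_(x in D) g x.
Proof.
move=> f0 fg; rewrite !ge0_integralE//; last first.
  by move=> x Dx; apply: le_trans (f0 _ Dx) (fg _ Dx).
apply: ereal_sup_le => _ [h hf <-]; exists h => // x.
apply: le_trans (hf x) _; rewrite /patch; by case: ifPn => [/set_mem/fg|].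
Qed.

Definition block (k : nat) : set R := `[(4 ^+ k)%R, (4 ^+ k.+1)%R[%classic.

Lemma mem_block r : (1 <= r)%R -> exists k, block k r.
Proof.
move=> r1; have ex : exists k : nat, (r < 4 ^+ k.+1)%R.
  exists (Num.truncn r); apply: lt_le_trans (truncnS_gt r) _.
  elim: (Num.truncn r).+1 => [|n IH]; first by rewrite expr0.
  by rewrite exprS -natr1; have : (1 <= 4 ^+ n :> R)%R; [rewrite exprn_ege1//; lra|lra].
case: (ex_minnP ex) => k rk kmin; exists k; rewrite /block/= in_itv/= rk andbT.
case: k rk kmin => [|k] _ kmin; first by rewrite expr0.
by rewrite leNgt; apply/negP => /kmin; rewrite ltnn.
Qed.

Lemma integral_block_le (f : R -> R) (b : nat -> R) (C : R) :
  (forall r, (1 <= r)%R -> (0 <= f r)%R) -> (forall k, (0 <= b k)%R) ->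
  (forall k r, block k r -> (f r <= b k)%R) ->
  (forall N, (\sum_(0 <= k < N) b k * (3 * 4 ^+ k) <= C)%R) ->
  \int[lebesgue_measure]_(r in `[1%R, +oo[) (f r)%:E <= C%:E.
Proof.
move=> f0 b0 fb bC.
have mB k : measurable (block k) by exact: measurable_itv.
apply: (@le_trans _ _ (\int[lebesgue_measure]_(r in `[1%R, +oo[)
   \sum_(k <oo) (b k * \1_(block k) r)%:E)).
  apply: ge0_le_integral_lower => r /=; rewrite in_itv/= andbT => r1.
    by rewrite lee_fin f0.
  have [k kr] := mem_block r1.
  apply: (@le_trans _ _ (\sum_(0 <= i < k.+1) (b i * \1_(block i) r)%:E)).
    rewrite big_nat_recr//= indicE mem_set// mulr1.
    rewrite -[leLHS]add0e; apply: leeD; last by rewrite lee_fin fb.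
    by apply: sume_ge0 => i _; rewrite lee_fin mulr_ge0// indicE.
  by apply: nneseries_lim_ge => i _ _; rewrite lee_fin mulr_ge0// indicE.
rewrite integral_nneseries//; last 2 first.
- move=> n; apply/measurable_EFinP; apply: measurable_funM => //.
  exact: (measurable_indic (mB n)).
- by move=> n r _; rewrite lee_fin mulr_ge0// indicE.
apply: lime_le.
  apply: is_cvg_nneseries => n _ _; apply: integral_ge0 => r _.
  by rewrite lee_fin mulr_ge0// indicE.
apply: nearW => N; apply: (@le_trans _ _ (\sum_(0 <= k < N) (b k * (3 * 4 ^+ k))%:E)); last first.
  by rewrite sumEFin lee_fin bC.
apply: lee_sum => k _.
under eq_integral do rewrite EFinM.
rewrite ge0_integralZl//; last 2 first.
- by apply/measurable_EFinP; exact: (measurable_indic (mB k)).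
- by rewrite lee_fin.
rewrite EFinM lee_wpmul2l ?lee_fin//.
rewrite integral_indic; [|exact: measurable_itv|exact: mB].
have h : (lebesgue_measure (block k `&` `[1%R, +oo[) <= lebesgue_measure (block k)).
  apply: le_measure; [apply/mem_set|apply/mem_set; exact: mB|exact: subIsetl].
  by apply: measurableI; [exact: mB|exact: measurable_itv].
apply: le_trans h _.
rewrite /block lebesgue_measure_itv/= lte_fin.
have k0 : (0 < 4 ^+ k :> R)%R by rewrite exprn_gt0.
rewrite ifT; last by rewrite exprS; lra.
by rewrite -EFinB lee_fin exprS; lra.
Qed.

End StepIntegral.

Section Conclusion.
Context {R : realType}.

Lemma exists_near_sup (A : set R) (f : R -> R) (C : R) : A !=set0 ->
  (forall r, A r -> 0 <= f r) -> (forall r, A r -> f r <= C) ->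
  exists r b, [/\ A r, 0 <= b, b <= 2 * f r & forall s, A s -> f s <= b].
Proof.
move=> [r0 Ar0] f0 fC.
have hs : has_sup (f @` A).
  by split; [exists (f r0), r0|exists C => _ [r Ar <-]; exact: fC].
have ub s : A s -> f s <= sup (f @` A).
  by move=> As; apply: ub_le_sup; [case: hs|exists s].
have [b0|b0] := leP (sup (f @` A)) 0.
  exists r0, 0; split => //; first by rewrite mulr_ge0// f0.
  by move=> s /ub /le_trans; exact.
have e0 : 0 < sup (f @` A) / 2 by lra.
have [_ [r Ar <-] h] := sup_adherent e0 hs.
exists r, (sup (f @` A)); split => //; [exact: ltW|lra].
Qed.

Lemma sum_even_odd (a : nat -> R) N :
  \sum_(0 <= k < 2 * N) a k =
  \sum_(0 <= i < N) a (2 * i)%N + \sum_(0 <= i < N) a (2 * i).+1.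
Proof.
elim: N => [|N IH]; first by rewrite muln0 !big_geq// addr0.
by rewrite mulnS add2n !big_nat_recr//= IH; ring.
Qed.

End Conclusion.

Theorem theorem1p2 (R : realType) (V : choiceType) (G : weighted_graph R V)
    (sigma : V -> R) (rho : V -> V -> R) (q : R)
    (q_gt1 : 1 < q)
    (sigma_gt0 : forall x, 0 < sigma x)
    (rho_edge : edge_length G rho)
    (rho_adapted : adapted G sigma rho)
    (rho_proper : proper_metric G rho)
    (volume_capacity : exists o : V,
      (\int[lebesgue_measure]_(r in `[1%R, +oo[)
         (r / (volume G sigma rho o (2 * r) `^ (q - 1))
          * ln (1 + volume G sigma rho o (2 * r)
                    / (r ^+ 2 * capacity G rho o r)))%:E = +oo)%E) :
  forall u : R -> V -> R, nonneg_supersolution G sigma q u ->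
  forall t x, 0 < t -> u t x = 0.
Proof.
move=> u u_super t0 x0 t00; apply: contrapT => /eqP u0.
have [u_ge0 _ _] := u_super.
have {u0}ux : 0 < u t0 x0 by rewrite lt0r u0 u_ge0.
case: volume_capacity => o intf.
pose f (r : R) : R := r / (volume G sigma rho o (2 * r) `^ (q - 1))
  * ln (1 + volume G sigma rho o (2 * r) / (r ^+ 2 * capacity G rho o r)).
pose M r := volume G sigma rho o r; pose Cp r := capacity G rho o r.
have M0 r : 0 <= r -> 0 < M r by move=> r0; exact: volume_gt0.
have Cp0 r : 0 < r -> 0 < Cp r.
  move=> r0; have [c c0 hc] := capacity_bounded_below o rho_edge rho_proper r.
  by apply: lt_le_trans c0 _; exact: hc.
have z0 r : 1 <= r -> 0 <= M (2 * r) / (r ^+ 2 * Cp r).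
  move=> r1; apply: divr_ge0; first by apply/ltW/M0; lra.
  by apply: mulr_ge0; [exact: sqr_ge0|apply/ltW/Cp0; lra].
have f0 r : 1 <= r -> 0 <= f r.
  move=> r1; rewrite /f mulr_ge0//; first by rewrite divr_ge0 ?powR_ge0//; lra.
  by rewrite ln_ge0// lerDl; exact: z0.
have block1 (k : nat) (r : R) : block k r -> 1 <= r.
  rewrite /block/= in_itv/= => /andP[h _]; apply: le_trans h.
  by rewrite exprn_ege1//; lra.
have fB k : exists C, forall r, block k r -> f r <= C.
  have [c c0 hc] := capacity_bounded_below o rho_edge rho_proper (4 ^+ k.+1).
  exists (4 ^+ k.+1 / M 0 `^ (q - 1) * (M (2 * 4 ^+ k.+1) / c)) => r kr.
  have r1 := block1 _ _ kr; move: kr; rewrite /block/= in_itv/= => /andP[_ r2].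
  apply: ler_pM.
  - by rewrite divr_ge0 ?powR_ge0//; lra.
  - by rewrite ln_ge0// lerDl; exact: z0.
  - apply: ler_pM; rewrite ?invr_ge0 ?powR_ge0 ?(ltW r2)//; first lra.
    rewrite lef_pV2 ?posrE ?powR_gt0 ?M0//; last lra.
    apply: ge0_ler_powR; rewrite ?nnegrE; [by rewrite subr_ge0 ltW| | |].
    + exact/ltW/M0.
    + by apply/ltW/M0; lra.
    + by apply: le_volume => //; lra.
  - apply: le_trans (le_ln1Dx _) _; first by have := z0 r r1; rewrite /M /Cp; lra.
    apply: ler_pM.
    + by apply/ltW/M0; lra.
    + by rewrite invr_ge0; apply: mulr_ge0; [exact: sqr_ge0|apply/ltW/Cp0; lra].
    + by apply: le_volume => //; rewrite ler_pM2l// ltW.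
    + have cC : c <= Cp r by apply: hc; [lra|exact: ltW].
      have rr : 1 <= r ^+ 2 by rewrite exprn_ege1.
      rewrite lef_pV2 ?posrE//; last by rewrite mulr_gt0 ?Cp0//; lra.
      by apply: le_trans cC _; rewrite ler_peMl// ltW// Cp0//; lra.
have near k : exists p : R * R, [/\ block k p.1,
    0 <= p.2, p.2 <= 2 * f p.1 & forall s, block k s -> f s <= p.2].
  have [C hC] := fB k.
  have [|r [b h]] := exists_near_sup _ (fun r kr => f0 r (block1 k r kr)) hC.
    exists (4 ^+ k); rewrite /block/= in_itv/= lexx/= exprS.
    have : (0 : R) < 4 ^+ k by rewrite exprn_gt0.
    lra.
  by exists (r, b).
have [rb rbP] := choice near.
pose r k := (rb k).1; pose b k := (rb k).2.
have rblock k : 4 ^+ k <= r k /\ r k < 4 ^+ k.+1.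
  by have [h _ _ _] := rbP k; move: h; rewrite /block/= in_itv/= => /andP[].
have r_ge1 k : 1 <= r k by have [h _ _ _] := rbP k; exact: block1 h.
have rsep k : 4 * r k <= r k.+2.
  have [_ h1] := rblock k; have [h2 _] := rblock k.+2.
  by apply: le_trans h2; rewrite exprS ler_pM2l// ltW.
have [k0 k0P] : exists k0 : nat, forall k, (k0 <= k)%N ->
    path_metric G rho o x0 <= r k / 2 /\ t0 <= r k ^+ 2.
  pose s := Num.max (2 * path_metric G rho o x0) t0.
  exists (Num.truncn s).+1 => k kk.
  have h : s <= r k.
    apply: le_trans (ltW (truncnS_gt s)) _.
    apply: (@le_trans _ _ (k%:R)); first by rewrite ler_nat.
    have [h _] := rblock k; apply: le_trans h.
    elim: (k) => [|n IH]; first by rewrite expr0.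
    rewrite exprS -natr1; have : (1 : R) <= 4 ^+ n by rewrite exprn_ege1//; lra.
    lra.
  move: h; rewrite /s ge_max => /andP[h1 h2]; split; first lra.
  by apply: le_trans h2 _; have := r_ge1 k; nra.
(* the terms of the weighted sums, equal to r k * f (r k) *)
pose w k := M (2 * r k) `^ (1 - q) *
  (r k ^+ 2 * ln (1 + M (2 * r k) / (r k ^+ 2 * Cp (r k)))).
have wE k : r k * f (r k) = w k.
  rewrite /w -(opprB q 1) powRN /f -/(M _) -/(Cp _).
  have : M (2 * r k) `^ (q - 1) != 0.
    by rewrite gt_eqF// powR_gt0// M0//; have := r_ge1 k; lra.
  move: (ln _) (M _ `^ _) => l m m0; by field.
pose a k := b k * (3 * 4 ^+ k).
have aw k : a k <= 6 * w k.
  have [_ b0 bf _] := rbP k; have [h _] := rblock k.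
  rewrite /a -wE; apply: (@le_trans _ _ (b k * (3 * r k))).
    by rewrite ler_wpM2l// ler_pM2l.
  have r3 : 0 <= 3 * r k by have := r_ge1 k; lra.
  have := ler_wpM2r r3 bf; rewrite -/(b k) -/(r k); lra.
(* radii taken from every other block are lacunary *)
have sub_bounded k1 : (k0 <= k1)%N -> exists C, forall N,
    \sum_(0 <= i < N) a (k1 + 2 * i)%N <= C.
  move=> kk; have [h1 h2] := k0P k1 kk.
  pose s i := r (k1 + 2 * i)%N.
  have s0 : s 0%N = r k1 by rewrite /s muln0 addn0.
  have s4 i : 4 * s i <= s i.+1 by rewrite /s mulnS add2n !addnS; exact: rsep.
  have [C hC] := weighted_sum_bounded_from sigma_gt0 rho_edge rho_adapted rho_proper
    q_gt1 u_super t00 ux (r_ge1 _ : 1 <= s 0%N)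
    (ltac:(by rewrite s0) : path_metric G rho o x0 <= s 0%N / 2)
    (ltac:(by rewrite s0)) s4.
  exists (6 * C) => N; apply: (@le_trans _ _ (6 * \sum_(0 <= i < N) w (k1 + 2 * i)%N)).
    by rewrite mulr_sumr; apply: ler_sum => i _; exact: aw.
  by rewrite ler_pM2l//; exact: hC.
have a0 k : 0 <= a k.
  by have [_ b0 _ _] := rbP k; rewrite mulr_ge0// mulr_ge0// exprn_ge0.
have [C hC] : exists C, forall N, \sum_(0 <= k < N) b k * (3 * 4 ^+ k) <= C.
  have [C1 h1] := sub_bounded k0 (leqnn _).
  have [C2 h2] := sub_bounded k0.+1 (leqnSn _).
  exists (\sum_(0 <= k < k0) a k + (C1 + C2)) => N.
  apply: (@le_trans _ _ (\sum_(0 <= k < k0 + 2 * N) a k)).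
    rewrite [leRHS](@big_cat_nat _ _ _ N)//=; last first.
      by rewrite mul2n -addnn addnA leq_addl.
    by rewrite lerDl; apply: sumr_ge0.
  rewrite (@big_cat_nat _ _ _ k0)//= ?leq_addr// lerD2l.
  rewrite -{1}[k0]add0n big_addn addKn.
  under eq_bigr do rewrite addnC.
  rewrite (sum_even_odd (fun i => a (k0 + i)%N)); apply: lerD; first exact: h1.
  by under eq_bigr do rewrite addnS -addSn; exact: h2.
have := integral_block_le f0 (fun k => (ltac:(by case: (rbP k)) : 0 <= b k))
  (fun k => (ltac:(by case: (rbP k)) : forall s, block k s -> f s <= b k)) hC.
by rewrite [X in (X <= _)%E]intf leye_eq.
Qed.
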